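(* In the setting described in the context (invariant section $i$ of $H\sim(F,G)$ over $u$ and the associated invariant bundle map $f$), assume: (a) hypotheses (H1a), (H2)(i, iv, v1$'$), (H3$'$), (H4), (H5$'$) of the context hold; (b) $F,G$ are $C^0$ and $C^1$-fiber with continuous fiber derivatives $D^vF,D^vG$, and $\sup_m\vartheta(m)\lambda_s(m)\lambda_u(m)<1$. Then: (1) The bundle map $K^1\in L_f(\Upsilon^V_X,\Upsilon^V_Y)$, $K^1_m(x)=Df_m(x)\in L(X_m,Y_m)$, is $C^0$, i.e. in local bundle charts it depends continuously (in operator norm) on $(m,x)$. (2) If for every $m\in M$, $DF_m(\cdot)$ and $DG_m(\cdot)$ are uniformly continuous, then so is $K^1_m(\cdot)$ for every $m$. If the families $DF_m(\cdot)$, $DG_m(\cdot)$, $m\in M$, are equicontinuous (uniformly continuous with modulus independent of $m$), then so is the family $K^1_m(\cdot)$, $m\in M$.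
   Context: A bundle $(X,M,\pi)$ is a surjection $\pi:X\to M$; its fibers $X_m$ are here Banach spaces. $H\sim(F,G)$ is a bundle correspondence over $u:M\to M$: $F_m:X_m\times Y_{u(m)}\to X_{u(m)}$, $G_m:X_m\times Y_{u(m)}\to Y_m$, $(x_2,y_2)\in H_m(x_1,y_1)\iff y_1=G_m(x_1,y_2),x_2=F_m(x_1,y_2)$. Conditions for $H_m$ (for all pairs of points $(x_1,y_1)\times(x_2,y_2)$, $(x_1',y_1')\times(x_2',y_2')$ of $\operatorname{Graph}H_m$, functions at $m$): (A)$(\alpha;\alpha',\lambda_u)$: $|x_1-x_1'|\le\alpha|y_1-y_1'|$ implies $|x_2-x_2'|\le\alpha'|y_2-y_2'|$ and $|y_1-y_1'|\le\lambda_u|y_2-y_2'|$; (B)$(\beta;\beta',\lambda_s)$: $|y_2-y_2'|\le\beta|x_2-x_2'|$ implies $|y_1-y_1'|\le\beta'|x_1-x_1'|$ and $|x_2-x_2'|\le\lambda_s|x_1-x_1'|$; (A$'$)$(\alpha,\lambda_u)$: $\sup_x\operatorname{Lip}F_m(x,\cdot)\le\alpha$, $\sup_x\operatorname{Lip}G_m(x,\cdot)\le\lambda_u$. Setting: $i=(i_X,i_Y)$ is an invariant section: $F_m(i_X(m),i_Y(u(m)))=i_X(u(m))$, $G_m(i_X(m),i_Y(u(m)))=i_Y(m)$. Either (I) (A$'$)$(\alpha,\lambda_u)$ (B)$(\beta;\beta',\lambda_s)$ holds with $\sup_m\alpha(m)\beta'(u(m))<1$, $\beta'(u(m))\le\beta(m)$,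 and $\vartheta(m)=(1-\alpha(m)\beta'(u(m)))^{-1}$; or (II) (A)$(\alpha;\alpha',\lambda_u)$ (B)$(\beta;\beta',\lambda_s)$ holds with $\sup_m\alpha'(m)\beta'(u(m))<1$, $\alpha'(m)\le\alpha(u(m))$, $\beta'(u(m))\le\beta(m)$, and $\vartheta\equiv1$. All these functions are bounded and $\sup_m\vartheta\lambda_s\lambda_u<1$. $f$ is the unique bundle map ($f_m:X_m\to Y_m$) with $\operatorname{Lip}f_m\le\beta'(m)$, $f_m(i_X(m))=i_Y(m)$, admitting $x_m:X_m\to X_{u(m)}$, $\operatorname{Lip}x_m\le\lambda_s(m)$, with $F_m(x,f_{u(m)}(x_m(x)))=x_m(x)$, $G_m(x,f_{u(m)}(x_m(x)))=f_m(x)$. (If all $F_m,G_m$ are $C^1$, then $f_m$ is $C^1$.) (H1a) $M$ is locally metrizable: a Hausdorff space with an open cover $\{U_m:m\in M\}$, $m\in U_m$, each $U_m$ carrying a metric $d_m$ inducing its subspace topology; $U_m(\epsilon)=\{m'\in U_m:d_m(m',m)<\epsilon\}$. $M_1\subset M$ is fixed. (H2)(i) The fibers of $X,Y$ are Banach spaces. (iv) $X,Y$ are $C^1$ topology bundles: each has an atlas of bundle charts $\varphi^{m_0}:U\times X_{m_0}\to X$, $(m,x)\mapsto(m,\varphi^{m_0}_m(x))$ ($\varphi^{m_0}_m:X_{m_0}\to X_m$ bijective, $\varphi^{m_0}_{m_0}=\mathrm{id}$), $m_0\in M$, over open domains with continuous transition maps (which topologizes $X$), such that $x\mapsto\varphi^{m_0}_m(x)$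 is $C^1$ and for transition maps $\varphi^{m_0,m_1}=(\varphi^{m_1})^{-1}\circ\varphi^{m_0}$ the map $(m,x)\mapsto D\varphi^{m_0,m_1}_m(x)$ is continuous. (v1$'$) For these charts at each $m_0\in M$ (with domain $U_{m_0}(\epsilon_{m_0})$), $\operatorname{Lip}(\varphi^{m_0}_m)^{\pm1}\le1+\eta_{m_0}(d_{m_0}(m,m_0))$ with $\limsup_{\delta\to0}\eta_{m_0}(\delta)\le\epsilon_*$, where $\epsilon_*>0$ is small (depending on the spectral gap condition); similarly for $Y$. (H3$'$) $i:M\to X\times Y$ is continuous. (H4) $u:M\to M$ is continuous and $u(M)\subset M_1$. (H5$'$) Each function $g$ in the (A$'$)(B) (or (A)(B)) condition is $\epsilon_*$-almost continuous: for each $m_0\in M$, $\sup_{m\in U_{m_0}(\sigma)}|g(m)-g(m_0)|\le\epsilon_*$ as $\sigma\to0$, where $\epsilon_*>0$ is small (depending on the spectral gap condition). $F$ and $G$ are regarded as bundle maps on the bundle over $M$ with fibers $X_m\times Y_{u(m)}$. ''$C^1$-fiber'' means each $F_m$ (resp. $G_m$) is $C^1$; $D^vF$ is the family $DF_m(z)$, and its continuity means continuity in $(m,z)$ of $DF_m(z)$ expressed in local charts. $\Upsilon^V_X$ is the vector bundle over $X$ with fiber $X_m$ at $(m,x)$. *)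

(* Defs.v *)
From HB Require Import structures.
From mathcomp Require Import all_boot all_order all_algebra.
From mathcomp Require Import all_classical all_reals all_analysis.

Set Implicit Arguments.
Unset Strict Implicit.
Unset Printing Implicit Defensive.

Import Order.TTheory GRing.Theory Num.Theory.
Import numFieldNormedType.Exports.

Local Open Scope classical_set_scope.
Local Open Scope ring_scope.

Section Operators.
Context {R : realType}.

(* Extended-real valued, so that it makes sense for every map; it is only
   applied to differences of differentials. *)
Definition opnorm (V W : normedModType R) (A : V -> W) : \bar R :=
  ereal_sup [set (`|A v|)%:E | v in [set v : V | `|v| <= 1]].

Definition op_continuous_on (T : topologicalType) (D : set T)
    (V W : normedModType R) (A : T -> V -> W) : Prop :=
  forall p, D p -> forall e : R, 0 < e ->
    \forall q \near within D (nbhs p), (opnorm (A q \- A p)%R <= e%:E)%E.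

Definition C1 (V W : normedModType R) (f : V -> W) : Prop :=
  (forall x, differentiable f x) /\
  op_continuous_on setT (fun x => 'd f x : V -> W).

Definition op_unif_continuous (Z V W : normedModType R) (A : Z -> V -> W) :=
  forall e : R, 0 < e -> exists2 delta : R, 0 < delta &
    forall z z' : Z, `|z - z'| <= delta ->
      (opnorm (A z \- A z')%R <= e%:E)%E.

Definition op_equicontinuous (I : Type) (Z V W : I -> normedModType R)
    (A : forall i, Z i -> V i -> W i) :=
  forall e : R, 0 < e -> exists2 delta : R, 0 < delta &
    forall i (z z' : Z i), `|z - z'| <= delta ->
      (opnorm (A i z \- A i z')%R <= e%:E)%E.

End Operators.

(* The fiberwise part of a chart is [chart i m : model i -> fib m], with
   inverse [chartV i m]; both are only meaningful for [m] in [dom i]. *)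
Record bundle (R : realType) (M : Type) := Bundle {
  fib :> M -> normedModType R;
  idx : Type;
  model : idx -> normedModType R;
  dom : idx -> set M;
  chart : forall (i : idx) (m : M), model i -> fib m;
  chartV : forall (i : idx) (m : M), fib m -> model i }.

Arguments model {R M} b i.
Arguments dom {R M} b i.
Arguments chart {R M} b i m.
Arguments chartV {R M} b i m.

Record total_space (R : realType) (M : Type) (B : bundle R M) := Pt {
  base : M;
  vec : B base }.

Arguments Pt {R M} B base vec.

HB.instance Definition _ (R : realType) (M : Type) (B : bundle R M) :=
  gen_eqMixin (total_space B).
HB.instance Definition _ (R : realType) (M : Type) (B : bundle R M) :=
  gen_choiceMixin (total_space B).

Section TotalTopology.
Context {R : realType} {M : topologicalType} (B : bundle R M).

Definition chart_map (i : idx B) (p : M * model B i) : total_space B :=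
  Pt B p.1 (chart B i p.1 p.2).

(* The final topology for the charts [dom i * model i -> total_space B]. *)
Definition total_open : set_system (total_space B) := fun W => forall i : idx B,
  open (@chart_map i @^-1` W : set (subspace (dom B i `*` [set: model B i]))).

Lemma total_openT : total_open setT.
Proof. by move=> i; rewrite preimage_setT; exact: openT. Qed.

Lemma total_openI : setI_closed total_open.
Proof.
by move=> A C oA oC i; rewrite preimage_setI; apply: openI; [exact: oA|exact: oC].
Qed.

Lemma total_open_bigcup (I : Type) (f : I -> set (total_space B)) :
  (forall i, total_open (f i)) -> total_open (\bigcup_i f i).
Proof.
move=> of_ j; rewrite preimage_bigcup; apply: bigcup_open => k _; exact: of_.
Qed.

HB.instance Definition _ := isOpenTopological.Build (total_space B)
  total_openT total_openI total_open_bigcup.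

End TotalTopology.

Section BundleMaps.
Context {R : realType} {M : topologicalType}.

Definition continuous_section (B : bundle R M) (s : forall m, B m) : Prop :=
  continuous (fun m => Pt B m (s m)).

Definition continuous_bmap (A B : bundle R M) (u : M -> M)
    (f : forall m, A m -> B (u m)) : Prop :=
  continuous (fun p : total_space A => Pt B (u (base p)) (f (base p) (vec p))).

(* For [K] a vector bundle map over [f] between the vertical bundles of [A]
   and [B] ([K m z] acts from the fiber of [A] over [m] to that of [B] over
   [u m]): continuity, for the operator norm, of all its local
   representatives.  The vertical bundles have the differentials of the
   charts as charts. *)
Definition continuous_vmap (A B : bundle R M) (u : M -> M)
    (f : forall m, A m -> B (u m))
    (K : forall m, A m -> A m -> B (u m)) : Prop :=
  forall (i : idx A) (j : idx B),
    op_continuous_on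
      [set p : M * model A i | dom A i p.1 /\ dom B j (u p.1)]
      (fun p : M * model A i =>
         let z := chart A i p.1 p.2 in
         ('d (chartV B j (u p.1)) (f p.1 z) : B (u p.1) -> model B j) \o
         K p.1 z \o
         ('d (chart A i p.1) (p.2) : model A i -> A p.1)).

Definition bprod (X Y : bundle R M) (u : M -> M) : bundle R M :=
  @Bundle R M (fun m => (X m * Y (u m))%type : normedModType R)
    (idx X * idx Y)%type
    (fun i => (model X i.1 * model Y i.2)%type : normedModType R)
    (fun i => dom X i.1 `&` u @^-1` dom Y i.2)
    (fun i m z => (chart X i.1 m z.1, chart Y i.2 (u m) z.2))
    (fun i m z => (chartV X i.1 m z.1, chartV Y i.2 (u m) z.2)).

End BundleMaps.

(* Bundles with Banach fibers and an atlas made of one chart [bchart m0],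
   modelled on the fiber over [m0], for each [m0 : M]. *)
Record banach_bundle (R : realType) (M : Type) := BanachBundle {
  bfib : M -> completeNormedModType R;
  bdom : M -> set M;
  bchart : forall m0 m : M, bfib m0 -> bfib m;
  bchartV : forall m0 m : M, bfib m -> bfib m0 }.

Arguments bdom {R M} b m0.
Arguments bchart {R M} b m0 m.
Arguments bchartV {R M} b m0 m.

Coercion bundle_of (R : realType) (M : Type) (X : banach_bundle R M) :
    bundle R M :=
  @Bundle R M (fun m => bfib X m : normedModType R) M
    (fun m0 => bfib X m0 : normedModType R) (bdom X) (bchart X) (bchartV X).

Definition transition (R : realType) (M : Type) (X : banach_bundle R M)
    (m0 m1 m : M) : X m0 -> X m1 :=
  bchartV X m1 m \o bchart X m0 m.

Arguments transition {R M} X m0 m1 m.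

Record C1_topology_bundle (R : realType) (M : topologicalType)
    (X : banach_bundle R M) : Prop := {
  c1_dom_open : forall m0, open (bdom X m0);
  c1_dom_center : forall m0, bdom X m0 m0;
  c1_chartK : forall m0 m, bdom X m0 m ->
    cancel (bchart X m0 m) (bchartV X m0 m);
  c1_chartVK : forall m0 m, bdom X m0 m ->
    cancel (bchartV X m0 m) (bchart X m0 m);
  c1_chart_id : forall m0 (x : X m0), bchart X m0 m0 x = x;
  c1_transition_continuous : forall m0 m1,
    {within (bdom X m0 `&` bdom X m1) `*` [set: X m0],
      continuous (fun p : M * X m0 => transition X m0 m1 p.1 p.2)};
  c1_chart : forall m0 m, bdom X m0 m ->
    C1 (bchart X m0 m : X m0 -> X m);
  c1_transition_diff : forall m0 m1 m, bdom X m0 m -> bdom X m1 m ->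
    forall x, differentiable (transition X m0 m1 m) x;
  c1_transition_C1 : forall m0 m1,
    op_continuous_on ((bdom X m0 `&` bdom X m1) `*` [set: X m0])
      (fun p : M * X m0 => 'd (transition X m0 m1 p.1) (p.2) : X m0 -> X m1) }.

(* [dist m] is a metric on [nb m]; its values elsewhere are irrelevant. *)
Record local_metrics (R : realType) (M : Type) := LocalMetrics {
  nb : M -> set M;
  dist : M -> M -> M -> R }.

Arguments nb {R M} l m.
Arguments dist {R M} l m.

Definition nb_ball (R : realType) (M : Type) (L : local_metrics R M)
    (m : M) (e : R) : set M :=
  [set m' | nb L m m' /\ dist L m m' m < e].

Record locally_metrizable (R : realType) (M : topologicalType)
    (L : local_metrics R M) : Prop := {
  lm_hausdorff : hausdorff_space M;
  lm_open : forall m, open (nb L m);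
  lm_center : forall m, nb L m m;
  lm_ge0 : forall m x y, nb L m x -> nb L m y -> 0 <= dist L m x y;
  lm_eq0 : forall m x y, nb L m x -> nb L m y ->
    (dist L m x y = 0 <-> x = y);
  lm_sym : forall m x y, nb L m x -> nb L m y ->
    dist L m x y = dist L m y x;
  lm_triangle : forall m x y z, nb L m x -> nb L m y -> nb L m z ->
    dist L m x z <= dist L m x y + dist L m y z;
  lm_topology : forall m x, nb L m x -> forall A : set M,
    within (nb L m) (nbhs x) A <->
    (exists2 e : R, 0 < e & forall y, nb L m y -> dist L m x y < e -> A y) }.

(* The bound on the Lipschitz constants of the charts only matters near their
   centers: the right-hand limsup ignores [eta m0 0], the chart being the
   identity over its center. *)
Definition almost_isometric_charts (R : realType) (M : Type)
    (L : local_metrics R M) (eps : R) (X : banach_bundle R M) : Prop :=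
  exists (rad : M -> R) (eta : M -> R -> R), forall m0,
    [/\ 0 < rad m0, bdom X m0 = nb_ball L m0 (rad m0),
      forall m, bdom X m0 m ->
        (1 + eta m0 (dist L m0 m m0)).-lipschitz (bchart X m0 m) /\
        (1 + eta m0 (dist L m0 m m0)).-lipschitz (bchartV X m0 m) &
      (limf_esup (fun delta : R => (eta m0 delta)%:E) 0^'+ <= eps%:E)%E].

(* The limit, as sigma tends to 0 from above, of the supremum of
   [|g m - g m0|] over the ball of radius sigma is at most [eps]. *)
Definition almost_continuous (R : realType) (M : Type)
    (L : local_metrics R M) (eps : R) (g : M -> R) : Prop :=
  forall m0, (limf_esup (fun sigma : R =>
    ereal_sup [set (`|g m - g m0|)%:E | m in nb_ball L m0 sigma])
    0^'+ <= eps%:E)%E.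

Section Correspondence.
Context {R : realType} {M : Type} (X Y : banach_bundle R M) (u : M -> M).
Variables (F : forall m, X m * Y (u m) -> X (u m))
          (G : forall m, X m * Y (u m) -> Y m).

Definition Graph (m : M) : set ((X m * Y m) * (X (u m) * Y (u m))) :=
  [set p | p.1.2 = G (p.1.1, p.2.2) /\ p.2.1 = F (p.1.1, p.2.2)].

Definition condA (alpha alpha' lambda_u : M -> R) : Prop :=
  forall m x1 y1 x2 y2 x1' y1' x2' y2',
    @Graph m ((x1, y1), (x2, y2)) -> @Graph m ((x1', y1'), (x2', y2')) ->
    `|x1 - x1'| <= alpha m * `|y1 - y1'| ->
    `|x2 - x2'| <= alpha' m * `|y2 - y2'| /\
    `|y1 - y1'| <= lambda_u m * `|y2 - y2'|.

Definition condB (beta beta' lambda_s : M -> R) : Prop :=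
  forall m x1 y1 x2 y2 x1' y1' x2' y2',
    @Graph m ((x1, y1), (x2, y2)) -> @Graph m ((x1', y1'), (x2', y2')) ->
    `|y2 - y2'| <= beta m * `|x2 - x2'| ->
    `|y1 - y1'| <= beta' m * `|x1 - x1'| /\
    `|x2 - x2'| <= lambda_s m * `|x1 - x1'|.

Definition condA' (alpha lambda_u : M -> R) : Prop :=
  forall m (x : X m),
    (alpha m).-lipschitz (fun y : Y (u m) => F (x, y)) /\
    (lambda_u m).-lipschitz (fun y : Y (u m) => G (x, y)).

Definition invariant_section (iX : forall m, X m) (iY : forall m, Y m) :=
  forall m, F (iX m, iY (u m)) = iX (u m) /\ G (iX m, iY (u m)) = iY m.

Definition invariant_map (beta' lambda_s : M -> R)
    (iX : forall m, X m) (iY : forall m, Y m)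
    (f : forall m, X m -> Y m) : Prop :=
  [/\ forall m, (beta' m).-lipschitz (f m : X m -> Y m),
    forall m, f m (iX m) = iY m &
    exists xm : forall m, X m -> X (u m), forall m,
      (lambda_s m).-lipschitz (xm m : X m -> X (u m)) /\
      forall x, F (x, f (u m) (xm m x)) = xm m x /\
                G (x, f (u m) (xm m x)) = f m x].

End Correspondence.

Section SpectralGap.
Context {R : realType} {M : Type} (X Y : banach_bundle R M) (u : M -> M).
Variables (F : forall m, X m * Y (u m) -> X (u m))
          (G : forall m, X m * Y (u m) -> Y m).
Variables (L : local_metrics R M) (eps C q : R).
Variables (alpha alpha' beta beta' lambda_u lambda_s theta : M -> R).

Definition admissible (g : M -> R) : Prop :=
  (forall m, 0 <= g m <= C) /\ almost_continuous L eps g.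

(* Suprema are bounded by [q], to be used with [q < 1]. *)
Definition setting_I : Prop :=
  [/\ condA' F G alpha lambda_u, condB F G beta beta' lambda_s,
    forall m, alpha m * beta' (u m) <= q,
    forall m, beta' (u m) <= beta m &
    forall m, theta m = (1 - alpha m * beta' (u m))^-1].

Definition setting_II : Prop :=
  [/\ condA F G alpha alpha' lambda_u /\ admissible alpha',
    condB F G beta beta' lambda_s,
    forall m, alpha' m * beta' (u m) <= q,
    forall m, alpha' m <= alpha (u m) /\ beta' (u m) <= beta m &
    forall m, theta m = 1].

Definition spectral_setting : Prop :=
  [/\ setting_I \/ setting_II,
    [/\ admissible alpha, admissible beta, admissible beta',
      admissible lambda_u & admissible lambda_s] &
    forall m, theta m * lambda_s m * lambda_u m <= q].

End SpectralGap.

Definition K1 (R : realType) (M : Type) (X Y : banach_bundle R M)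
    (f : forall m, X m -> Y m) (m : M) (x : X m) : X m -> Y m :=
  'd (f m) x.
Arguments K1 {R M X Y} f m x.

Definition Dv (R : realType) (M : Type) (A B : bundle R M) (u : M -> M)
    (F : forall m, A m -> B (u m)) (m : M) (z : A m) : A m -> B (u m) :=
  'd (F m) z.
Arguments Dv {R M A B u} F m z.

(* Main.v *)
(* Two nearby configurations over an orbit are compared: difference quotients
   at one point, differentials at two points of a fiber, or values and
   differentials over neighboring base points, identified by the chart centered
   at one of them.  Let [n] be the discrepancy of the values of [f] and [r] the
   size of the arguments.  The cone conditions, extended to pairs violating the
   cone by a small amount, give [n <= lambda_u * n' + small], with [n'] the
   discrepancy one step further along the orbit, where [r' <= lambda_s * r].
   So a bound [n <= k * r + small] valid over all orbits improves to
   [n <= theta * lambda_s * lambda_u * k * r + small], and by iteration [n] is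
   arbitrarily small. *)
Require Import Defs.
From HB Require Import structures.
From mathcomp Require Import all_boot all_order all_algebra.
From mathcomp Require Import all_classical all_reals all_analysis.
From mathcomp Require Import lra ring.

Set Implicit Arguments.
Unset Strict Implicit.
Unset Printing Implicit Defensive.

Import Order.TTheory GRing.Theory Num.Theory.
Import numFieldNormedType.Exports.

Local Open Scope classical_set_scope.
Local Open Scope ring_scope.

(** * Linear identities and difference quotients *)

(** The thresholds of closeness depend on the reference point, and nothing is uniform along its
    orbit. So the bound with constant [k] is quantified over all reference points at once, each with
    its own filter of nearby configurations, and an improved bound at one point only calls on the
    bound at the next. For a prescribed accuracy finitely many improvements suffice, so only
    finitely many points of an orbit are ever constrained. The bound is linear in the size of the
    arguments because [lambda_s] may exceed 1: orbits may then move away, and only the product of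
    the rates contracts. For values of [f] the size is the distance to the invariant section, where
    [f] is known beforehand to vary continuously with the base point. The starting constant comes
    from Lipschitz bounds alone. Charts distort norms, but this does not spoil the rate: sizes are
    measured in the fiber of the reference point and discrepancies in that of the perturbed one, so
    chart constants only enter the starting bound and vanishing errors. The price is a rate mixing
    two base points, controlled by the almost continuity of [lambda_s]. *)

Section ModuleReflection.
Context {R : comRingType} {V : lmodType R}.

Inductive lexp := LVar of nat | LZero | LAdd of lexp & lexp | LOpp of lexp
  | LScale of R & lexp.

Fixpoint leval (env : seq V) (e : lexp) : V :=
  match e with
  | LVar j => env`_j
  | LZero => 0
  | LAdd a b => leval env a + leval env b
  | LOpp a => - leval env a
  | LScale k a => k *: leval env a
  end.

Fixpoint lcoef (e : lexp) (i : nat) : R :=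
  match e with
  | LVar j => if eqn i j then 1 else 0
  | LZero => 0
  | LAdd a b => lcoef a i + lcoef b i
  | LOpp a => - lcoef a i
  | LScale k a => k * lcoef a i
  end.

Lemma leval_coef env e :
  leval env e = \sum_(i < size env) lcoef e i *: env`_i.
Proof.
elim: e => [j||a Ha b Hb|a Ha|k a Ha] /=; rewrite ?Ha ?Hb ?eqnE.
- have [jn|nj] := ltnP j (size env).
    rewrite (bigD1 (Ordinal jn)) //= eqxx scale1r big1 ?addr0 // => i ij.
    by rewrite ifF ?scale0r //; apply/negbTE.
  rewrite nth_default // big1 // => i _; rewrite ifF ?scale0r //.
  by apply/negbTE; rewrite neq_ltn (leq_trans (ltn_ord i)).
- by rewrite big1 // => i _; rewrite scale0r.
- by rewrite -big_split; apply: eq_bigr => i _; rewrite scalerDl.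
- by rewrite -sumrN; apply: eq_bigr => i _; rewrite scaleNr.
- by rewrite scaler_sumr; apply: eq_bigr => i _; rewrite scalerA.
Qed.

(** The atoms are treated as independent, so equality of coefficients is a sufficient criterion: one
    ring identity per atom. *)
Lemma leval_eq env a b :
  foldr (fun i P => lcoef a i = lcoef b i /\ P) True (iota 0 (size env)) ->
  leval env a = leval env b.
Proof.
move=> ab; rewrite !leval_coef; apply: eq_bigr => -[i /= il] _; congr (_ *: _).
have: i \in iota 0 (size env) by rewrite mem_iota.
by elim: (iota _ _) ab => //= k s IH [ek es]; rewrite inE => /predU1P[->|/IH->].
Qed.

End ModuleReflection.

Ltac lmod_mem x l :=
  lazymatch l with
  | nil => constr:(false)
  | x :: _ => constr:(true)
  | _ :: ?l' => lmod_mem x l'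
  end.
Ltac lmod_index x l :=
  lazymatch l with
  | x :: _ => constr:(0%N)
  | _ :: ?l' => let n := lmod_index x l' in constr:(S n)
  end.
Ltac lmod_vars t l :=
  lazymatch t with
  | GRing.add ?a ?b => let l1 := lmod_vars a l in lmod_vars b l1
  | GRing.opp ?a => lmod_vars a l
  | GRing.scale _ ?a => lmod_vars a l
  | GRing.zero => l
  | _ => lazymatch lmod_mem t l with
         | true => l
         | false => constr:(t :: l)
         end
  end.
Ltac lmod_reify R t l :=
  lazymatch t with
  | GRing.add ?a ?b =>
      let a1 := lmod_reify R a l in let b1 := lmod_reify R b l in
      constr:(@LAdd R a1 b1)
  | GRing.opp ?a => let a1 := lmod_reify R a l in constr:(@LOpp R a1)
  | GRing.scale ?k ?a =>
      let a1 := lmod_reify R a l in constr:(@LScale R k a1)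
  | GRing.zero => constr:(@LZero R)
  | _ => let n := lmod_index t l in constr:(@LVar R n)
  end.

(* Decides identities between linear combinations in a module over the real
   type [R], up to the commutative ring identities between the coefficients. *)
Ltac lmod R :=
  lazymatch goal with
  | |- @eq ?V ?a ?b =>
      let l0 := lmod_vars a (@nil V) in
      let l := lmod_vars b l0 in
      let a1 := lmod_reify R a l in
      let b1 := lmod_reify R b l in
      apply: (@leval_eq R _ l a1 b1); rewrite /=;
      repeat (split; [try ring|]); try exact I
  end.


Section Calculus.
Context {R : realType}.

Lemma lipschitzP (V W : normedModType R) (k : R) (f : V -> W) :
  k.-lipschitz f -> forall x y, `|f x - f y| <= k * `|x - y|.
Proof. by move=> fk x y; apply: (fk (x, y)). Qed.

Lemma norm_pair (V W : normedModType R) (x : V) (y : W) :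
  `|(x, y)| = Num.max `|x| `|y|.
Proof. by rewrite prod_normE. Qed.

Lemma norm_pair_le (V W : normedModType R) (x : V) (y : W) :
  `|(x, y)| <= `|x| + `|y|.
Proof. by rewrite norm_pair ge_max lerDl lerDr !normr_ge0. Qed.

Lemma opnorm_leP (V W : normedModType R) (A : V -> W) (e : R) :
  (opnorm A <= e%:E)%E <-> forall v, `|v| <= 1 -> `|A v| <= e.
Proof.
split=> [Ae v v1|Ae].
  by rewrite -lee_fin (le_trans _ Ae) //; apply: ereal_sup_ubound; exists v.
by apply: ge_ereal_sup => _ [v /= v1 <-]; rewrite lee_fin; apply: Ae.
Qed.

(** Only positive homogeneity is asked of [A], so that differences of composed differentials qualify
    without being packaged as linear maps. *)
Lemma le_norm_scale (V W : normedModType R) (A : V -> W) (e : R) :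
  (forall k v, 0 < k -> A (k *: v) = k *: A v) -> A 0 = 0 ->
  (forall v, `|v| <= 1 -> `|A v| <= e) -> forall v, `|A v| <= e * `|v|.
Proof.
move=> AZ A0 Ae v; have [->|v0] := eqVneq v 0.
  by rewrite A0 !normr0 mulr0.
have nv : 0 < `|v| by rewrite normr_gt0.
have -> : v = `|v| *: (`|v|^-1 *: v) by rewrite scalerA divff ?scale1r ?gt_eqF.
rewrite AZ // [in leLHS]normrZ normr_id mulrC [in leRHS]scalerA divff ?gt_eqF //.
rewrite scale1r ler_wpM2r //; apply: Ae.
by rewrite normrZ normfV normr_id mulVf // gt_eqF.
Qed.

Lemma diff_remainder_le (V W : normedModType R) (f : V -> W) (x : V) (r e : R) :
  differentiable f x -> 0 < e ->
  exists2 d : R, 0 < d & forall t v, 0 < t <= d -> `|v| <= r ->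
    `|f (x + t *: v) - f x - t *: 'd f x v| <= t * e.
Proof.
move=> /diff_locallyP[_ /eqaddoP fx] e0.
pose r1 := `|r| + 1; have r1_gt0 : 0 < r1 by rewrite /r1 ltr_wpDl.
have /fx /nbhs_normP[d d0 fd] : 0 < e / r1 by rewrite divr_gt0.
exists (d / (2 * r1)); first by rewrite divr_gt0 // mulr_gt0.
move=> t v /andP[t0 td] vr.
have vr1 : `|v| <= r1 by rewrite /r1 (le_trans vr) // ler_wpDr // ler_norm.
have : `|t *: v| < d.
  rewrite normrZ gtr0_norm // (le_lt_trans (ler_pM _ _ td vr1)) // ?(ltW t0) //.
  have -> : d / (2 * r1) * r1 = d / 2 by field; rewrite gt_eqF.
  by rewrite ltr_pdivrMr // ltr_pMr // ltr1n.
move=> tvd; have := fd (t *: v); rewrite /= sub0r normrN => /(_ tvd).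
rewrite -[X in `|X| <= _ -> _]/(f (t *: v + x) - (f x + 'd f x (t *: v))).
rewrite linearZ /= opprD addrA [t *: v + x]addrC => /le_trans; apply.
rewrite normrZ gtr0_norm // mulrCA ler_wpM2l ?(ltW t0) //.
by rewrite mulrAC ler_pdivrMr // ler_wpM2l // ltW.
Qed.

Lemma diff_quotient_le (V W : normedModType R) (f : V -> W) (x : V) (r e : R) :
  differentiable f x -> 0 < e ->
  exists2 d : R, 0 < d & forall t v, 0 < t <= d -> `|v| <= r ->
    `|t^-1 *: (f (x + t *: v) - f x) - 'd f x v| <= e.
Proof.
move=> fx e0; have [d d0 fd] := diff_remainder_le r fx e0; exists d => // t v td vr.
have /andP[t0 _] := td; have := fd t v td vr.
rewrite -ler_pdivrMl // -[t^-1 * _]/(t^-1 * _) -[X in X * `|_|](gtr0_norm (_ : 0 < t^-1)) ?invr_gt0 //.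
rewrite -normrZ; congr (`|_| <= _); lmod R; by field; rewrite gt_eqF.
Qed.

Lemma diff_lipschitz (V W : normedModType R) (f : V -> W) (x v : V) (k : R) :
  k.-lipschitz f -> differentiable f x -> `|'d f x v| <= k * `|v|.
Proof.
move=> /lipschitzP fk fx; apply/ler_addgt0Pr => e e0.
have [d d0 fd] := diff_quotient_le `|v| fx e0.
have := fd d v; rewrite d0 !lexx => /(_ isT isT) fdv.
rewrite -[X in `|X|](subKr (d^-1 *: (f (x + d *: v) - f x))).
rewrite (le_trans (ler_normB _ _)) // lerD // normrZ normfV gtr0_norm //.
rewrite ler_pdivrMl // (le_trans (fk _ _)) // [x + _]addrC addrK normrZ gtr0_norm //.
by rewrite mulrCA.
Qed.

(* Asymptotic additivity of the difference quotients yields, with zero as the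
   second increment, their convergence, uniform on bounded sets. *)
Lemma differentiable_defect (V : normedModType R) (W : completeNormedModType R)
    (f : V -> W) (x : V) (k : R) :
  k.-lipschitz f ->
  (forall r e, 0 < e -> exists2 d : R, 0 < d &
    forall s s1 s2 v1 v2, 0 < s <= d -> 0 < s1 <= d -> 0 < s2 <= d ->
      `|v1| <= r -> `|v2| <= r ->
      `|s^-1 *: (f (x + s *: (v1 + v2)) - f x) -
        (s1^-1 *: (f (x + s1 *: v1) - f x) +
         s2^-1 *: (f (x + s2 *: v2) - f x))| <= e) ->
  differentiable f x.
Proof.
move=> /lipschitzP fk fadd.
pose g s v : W := s^-1 *: (f (x + s *: v) - f x).
have g0 s : g s 0 = 0 by rewrite /g scaler0 addr0 subrr scaler0.
have rnear (d : R) : 0 < d -> \forall s \near 0^'+, 0 < s <= d.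
  move=> d0; near=> s; apply/andP; split; near: s.
    exact: nbhs_right_gt.
  exact: nbhs_right_ltW.
have gcvg v : cvg (g s v @[s --> 0^'+]).
  apply: cauchy_cvg; apply: cauchy_exP => e e0.
  have e20 : 0 < e / 2 by rewrite divr_gt0.
  have [d d0 fd] := fadd `|v| (e / 2) e20.
  exists (g d v); rewrite /fmap /=; near=> s.
  rewrite -ball_normE /=.
  have sd : 0 < s <= d by near: s; exact: rnear.
  have := fd d s s v 0; rewrite d0 !lexx normr0 normr_ge0 addr0.
  rewrite sd -!/(g _ _) g0 addr0 => /(_ isT isT isT isT isT) /le_lt_trans; apply.
  by rewrite ltr_pdivrMr // ltr_pMr // ltr1n.
pose L v : W := lim (g s v @[s --> 0^'+]).
have gL v : g s v @[s --> 0^'+] --> L v by exact: gcvg.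
have gLe r e : 0 < e -> exists2 d : R, 0 < d &
    forall s v, 0 < s <= d -> `|v| <= r -> `|g s v - L v| <= e.
  move=> e0; have [d d0 fd] := fadd `|r| e e0; exists d => // s v sd vr.
  have : `|g s v - g t v| @[t --> 0^'+] --> `|g s v - L v|.
    by apply: cvg_norm; apply: cvgB; [exact: cvg_cst|exact: gL].
  move=> /cvgr_to_le; apply; near=> t.
  have := fd s t t v 0; rewrite sd normr0 normr_ge0 addr0 -!/(g _ _) g0 addr0.
  apply => //; try by (near: t; exact: rnear).
  by rewrite (le_trans vr) // ler_norm.
have eq_small (a b : W) : (forall e, 0 < e -> `|a - b| <= e) -> a = b.
  move=> ab; apply/eqP; rewrite -subr_eq0 -normr_le0; apply/ler_addgt0Pr => e e0.
  by rewrite add0r; apply: ab.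
have LD v w : L (v + w) = L v + L w.
  apply: eq_small => e e0; have e40 : 0 < e / 4 by rewrite divr_gt0.
  have [d1 d10 H1] := gLe (`|v| + `|w|) _ e40.
  have [d2 d20 H2] := fadd (`|v| + `|w|) _ e40.
  have d0 : 0 < Num.min d1 d2 by rewrite lt_min d10.
  have [s1 s2] : 0 < Num.min d1 d2 <= d1 /\ 0 < Num.min d1 d2 <= d2.
    by rewrite d0 !ge_min !lexx orbT.
  set s := Num.min d1 d2 in s1 s2 d0.
  have vr : `|v| <= `|v| + `|w| by rewrite lerDl.
  have wr : `|w| <= `|v| + `|w| by rewrite lerDr.
  have A := H1 s _ s1 vr; have B := H1 s _ s1 wr.
  have D := H1 s _ s1 (ler_normD v w).
  have := H2 s s s _ _ s2 s2 s2 vr wr; rewrite -!/(g _ _) => E.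
  have -> : L (v + w) - (L v + L w) = (g s (v + w) - (g s v + g s w))
     - (g s (v + w) - L (v + w)) + (g s v - L v) + (g s w - L w) by lmod R.
  rewrite (le_trans (ler_normD _ _)) // (le_trans (lerD (ler_normD _ _) B)) //.
  rewrite (le_trans (lerD (lerD (ler_normB _ _) A) (lexx _))) //.
  by rewrite (le_trans (lerD (lerD (lerD E D) (lexx _)) (lexx _))) //; lra.
have L0 : L 0 = 0 by apply: (addrI (L 0)); rewrite -LD !addr0.
have LN v : L (- v) = - L v.
  by apply: (addrI (L v)); rewrite -LD !subrr.
(* Homogeneity is a change of step: the quotient of [c *: v] at step [s] is [c] times the quotient
   of [v] at step [c * s]. *)
have LZ0 c v : 0 < c -> L (c *: v) = c *: L v.
  move=> c0; apply: eq_small => e e0.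
  have e1 : 0 < e / 2 by rewrite divr_gt0.
  have e2 : 0 < e / 2 / c by rewrite divr_gt0.
  have [d1 d10 H1] := gLe `|c *: v| _ e1.
  have [d2 d20 H2] := gLe `|v| _ e2.
  pose s := Num.min d1 (d2 / c).
  have s0 : 0 < s by rewrite lt_min d10 divr_gt0.
  have s1 : 0 < s <= d1 by rewrite s0 ge_min lexx.
  have s2 : 0 < c * s <= d2.
    by rewrite mulr_gt0 //= mulrC -ler_pdivlMr // /s ge_min lexx orbT.
  have A := H1 _ _ s1 (lexx _); have B := H2 _ _ s2 (lexx _).
  have gE : g s (c *: v) = c *: g (c * s) v.
    rewrite /g scalerA mulrC scalerA invfM mulrA divff ?mul1r // gt_eqF //.
  have -> : L (c *: v) - c *: L v = c *: (g (c * s) v - L v) - (g s (c *: v) - L (c *: v)).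
    by rewrite gE; lmod R.
  rewrite (le_trans (ler_normB _ _)) // normrZ gtr0_norm // (splitr e) lerD //.
  by rewrite mulrC -ler_pdivlMr.
have LZ c v : L (c *: v) = c *: L v.
  case: (ltgtP c 0) => [c0|c0|->]; last by rewrite !scale0r.
    have := LZ0 (- c) v; rewrite oppr_gt0 => /(_ c0).
    by rewrite !scaleNr LN => /oppr_inj.
  exact: LZ0.
have Llin : linear L by move=> c v w; rewrite LD LZ.
pose L' : {linear V -> W} := HB.pack L (GRing.isLinear.Build R V W *:%R L Llin).
(* For boundedness one crude comparison with a quotient is enough; the tolerance chosen is [|v|]
   itself. *)
have Lk v : `|L v| <= (`|k| + 1) * `|v|.
  have [->|v0] := eqVneq v 0; first by rewrite L0 !normr0 mulr0.
  have nv : 0 < `|v| by rewrite normr_gt0.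
  have [d d0 H] := gLe `|v| _ nv.
  have := H d v; rewrite d0 !lexx => /(_ isT isT) Hd.
  rewrite -[L v](subKr (g d v)) (le_trans (ler_normB _ _)) // mulrDl mul1r lerD //.
  rewrite normrZ normfV gtr0_norm // ler_pdivrMl // (le_trans (fk _ _)) //.
  rewrite [x + _]addrC addrK normrZ gtr0_norm // mulrCA ler_wpM2l ?(ltW d0) //.
  by rewrite ler_wpM2r // ler_norm.
have Lc : continuous L'.
  apply/linear_bounded_continuous/bounded_funP => r.
  exists ((`|k| + 1) * r) => v vr; by rewrite (le_trans (Lk v)) // ler_wpM2l.
have fL : f \o shift x = cst (f x) + L' +o_ 0 id.
  apply/eqaddoP => e e0; have [d d0 H] := gLe 1 e e0.
  apply/nbhs_normP; exists d => // h; rewrite /= sub0r normrN => hd.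
  rewrite !fctE /=; have [->|h0] := eqVneq h 0.
    by rewrite L0 add0r addr0 subrr !normr0 mulr0.
  have nh : 0 < `|h| by rewrite normr_gt0.
  have := H `|h| (`|h|^-1 *: h).
  rewrite nh (ltW hd) normrZ normfV normr_id mulVf ?gt_eqF // lexx => /(_ isT isT).
  rewrite LZ /g scalerA divff ?gt_eqF // scale1r -scalerBr normrZ normfV normr_id.
  by rewrite ler_pdivrMl // mulrC opprD addrA [h + x]addrC.
have dfL := diff_unique Lc fL.
by apply/diff_locallyP; rewrite dfL.
Unshelve. all: by end_near.
Qed.

End Calculus.

(** * Cone conditions with defects *)

Section RobustCone.
Context {R : realType} {V W2 V2 W : normedModType R}.

(** The defect [s] enters homogeneously, like the norms. Hence the condition is invariant under
    rescaling and passes, with the same constants, to difference quotients and to differentials. *)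
Definition robust_cone (F : V * W2 -> V2) (G : V * W2 -> W) (a p l c : R) :=
  forall x x' y y' s, 0 <= s ->
    `|x' - x| <= a * `|G (x', y') - G (x, y)| + s ->
    `|F (x', y') - F (x, y)| <= p * `|y' - y| + c * s /\
    `|G (x', y') - G (x, y)| <= l * `|y' - y| + c * s.

(* When [x' - x] violates the cone by [s], move [x'] towards [x] by
   [s / (1 - q)]: this changes [G] by at most [b * s / (1 - q)], which
   [a * b <= q] makes compatible with the cone condition. *)
Lemma robust_cone_exact F G (a b p l ls q C : R) :
  0 <= a -> a * b <= q -> q < 1 -> 0 <= C -> b <= C -> ls <= C ->
  (forall x x' y, `|F (x', y) - F (x, y)| <= ls * `|x' - x|) ->
  (forall x x' y, `|G (x', y) - G (x, y)| <= b * `|x' - x|) ->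
  (forall x x' y y', `|x' - x| <= a * `|G (x', y') - G (x, y)| ->
    `|F (x', y') - F (x, y)| <= p * `|y' - y| /\
    `|G (x', y') - G (x, y)| <= l * `|y' - y|) ->
  robust_cone F G a p l (C / (1 - q)).
Proof.
move=> a0 abq q1 C0 bC lsC FX GX cone x x' y y' s s0 xx.
have q1' : 0 < 1 - q by rewrite subr_gt0.
set c0 := (1 - q)^-1; have c00 : 0 < c0 by rewrite invr_gt0.
have [x'' [x1 x2]] : exists x'', `|x' - x''| <= c0 * s /\
    `|x'' - x| <= a * `|G (x'', y') - G (x, y)|.
  (* If [x'] is closer to [x] than the required displacement, it can be moved onto [x], where the
     cone condition is trivial. *)
  have [xs|xs] := leP `|x' - x| (c0 * s).
    by exists x; split=> //; rewrite subrr normr0 mulr_ge0.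
  have cs0 : 0 <= c0 * s by rewrite mulr_ge0 // ltW.
  have D0 : 0 < `|x' - x| by rewrite (le_lt_trans _ xs).
  pose tau := c0 * s / `|x' - x|.
  have tau0 : 0 <= tau by rewrite divr_ge0 // ltW.
  have tau1 : tau <= 1 by rewrite ler_pdivrMr // mul1r ltW.
  exists (x' + tau *: (x - x')).
  have H1 : `|x' - (x' + tau *: (x - x'))| = c0 * s.
    have -> : x' - (x' + tau *: (x - x')) = tau *: (x' - x) by lmod R.
    by rewrite normrZ ger0_norm // divfK // gt_eqF.
  split; first by rewrite H1.
  have -> : x' + tau *: (x - x') - x = (1 - tau) *: (x' - x) by lmod R.
  rewrite normrZ ger0_norm ?subr_ge0 // mulrBl mul1r divfK ?gt_eqF //.
  have G1 : `|G (x', y') - G (x' + tau *: (x - x'), y')| <= b * (c0 * s).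
    by rewrite -H1; exact: GX.
  set g2 := G (x' + tau *: (x - x'), y') in G1 *.
  have := ler_wpM2l a0 (le_trans (ler_distD g2 (G (x', y')) (G (x, y)))
    (lerD G1 (lexx _))).
  have abK := ler_wpM2r cs0 abq.
  have sE : s = c0 * s - q * (c0 * s) by rewrite /c0; field; rewrite gt_eqF.
  rewrite mulrDr mulrA => G2; clear -xx G2 abK sE; lra.
have [A B] := cone _ _ _ _ x2.
have bs : C * `|x' - x''| <= C / (1 - q) * s by rewrite -mulrA ler_wpM2l.
split.
  rewrite (le_trans (ler_distD (F (x'', y')) _ _)) // addrC lerD //.
  by rewrite (le_trans (FX _ _ _)) // (le_trans _ bs) // ler_wpM2r.
rewrite (le_trans (ler_distD (G (x'', y')) _ _)) // addrC lerD //.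
by rewrite (le_trans (GX _ _ _)) // (le_trans _ bs) // ler_wpM2r.
Qed.

(** In the applications [(x', y')] is an exact configuration, while [x2] and [y1] are transported
    images of a reference configuration, which [F] and [G] reproduce only up to [e]. An error [e] on
    the [G] side widens the cone defect by [a * e]. *)
Lemma robust_cone_approx F G (a p l c : R) x x' y y' x2 y1 d e :
  robust_cone F G a p l c -> 0 <= a -> 0 <= c -> 0 <= d ->
  `|F (x, y) - x2| <= e -> `|G (x, y) - y1| <= e ->
  `|x' - x| <= a * `|G (x', y') - y1| + d ->
  `|F (x', y') - x2| <= p * `|y' - y| + (c * (d + a * e) + e) /\
  `|G (x', y') - y1| <= l * `|y' - y| + (c * (d + a * e) + e).
Proof.
move=> cone a0 c0 d0 Fe Ge xx.
have e0 : 0 <= e by rewrite (le_trans _ Fe).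
have [A B] : `|F (x', y') - F (x, y)| <= p * `|y' - y| + c * (d + a * e) /\
    `|G (x', y') - G (x, y)| <= l * `|y' - y| + c * (d + a * e).
  apply: cone; first by rewrite addr_ge0 // mulr_ge0.
  rewrite (le_trans xx) // addrC [leRHS]addrCA lerD // -mulrDr ler_wpM2l //.
  by rewrite (le_trans (ler_distD (G (x, y)) _ _)) // lerD.
rewrite !addrA; split.
  by rewrite (le_trans (ler_distD (F (x, y)) _ _)) // lerD.
by rewrite (le_trans (ler_distD (G (x, y)) _ _)) // lerD.
Qed.

Lemma robust_cone_quotient F G (a p l c : R) (z : V * W2) (t : R) : 0 < t ->
  robust_cone F G a p l c ->
  robust_cone (fun w => t^-1 *: (F (z + t *: w) - F z))
    (fun w => t^-1 *: (G (z + t *: w) - G z)) a p l c.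
Proof.
case: z => z1 z2 t0 cone x x' y y' s s0 xx.
have ti0 : 0 < t^-1 by rewrite invr_gt0.
have E (U : normedModType R) (f : V * W2 -> U) u u' :
    `|t^-1 *: (f u' - f (z1, z2)) - t^-1 *: (f u - f (z1, z2))| =
    t^-1 * `|f u' - f u|.
  rewrite -[X in X * _](gtr0_norm ti0) -normrZ; congr `|_|; lmod R.
move: xx; rewrite !E => xx.
have N (U : normedModType R) (w u u' : U) : `|(w + t *: u') - (w + t *: u)| = t * `|u' - u|.
  rewrite -[X in X * _](gtr0_norm t0) -normrZ; congr `|_|; lmod R.
have := cone (z1 + t *: x) (z1 + t *: x') (z2 + t *: y) (z2 + t *: y') (t * s).
rewrite !N mulr_ge0 ?(ltW t0) // => /(_ isT) [|A B].
  rewrite -ler_pdivlMl // mulrDr mulKf ?gt_eqF // mulrCA; exact: xx.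
split; rewrite ler_pdivrMl // mulrDr.
  by rewrite mulrCA [t * (c * s)]mulrCA; exact: A.
by rewrite mulrCA [t * (c * s)]mulrCA; exact: B.
Qed.

(** By linearity only the increment [w] matters. Quotients at a small step satisfy the condition
    with the same constants; replacing a differential by its quotient costs [a * e] in the defect
    and [e] in the conclusion, and [e] is arbitrary. *)
Lemma robust_cone_diff F G (a p l c : R) (z : V * W2) :
  0 <= a -> 0 <= c -> differentiable F z -> differentiable G z ->
  robust_cone F G a p l c -> robust_cone ('d F z) ('d G z) a p l c.
Proof.
move=> a0 c0 dF dG cone x x' y y' s s0 xx.
pose w := (x' - x, y' - y).
have EF (U : normedModType R) (f : {linear (V * W2)%type -> U}) :
  f (x', y') - f (x, y) = f w by rewrite -linearB.
move: xx; rewrite !EF => xx.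
suff H e : 0 < e -> `|'d F z w| <= p * `|y' - y| + c * s + e * (1 + c * a + 1) /\
    `|'d G z w| <= l * `|y' - y| + c * s + e * (1 + c * a + 1).
  have K : 0 < 1 + c * a + 1 by rewrite ltr_wpDl // addr_ge0 // mulr_ge0.
  by split; apply/ler_addgt0Pr => e e0;
     have [] := H (e / (1 + c * a + 1)) (divr_gt0 e0 K); rewrite divfK ?gt_eqF.
move=> e0.
have [d1 d10 H1] := diff_quotient_le `|w| dF e0.
have [d2 d20 H2] := diff_quotient_le `|w| dG e0.
pose t := Num.min d1 d2.
have t0 : 0 < t by rewrite lt_min d10.
have {}H1 := H1 t w; have {}H2 := H2 t w.
move: H1 H2; rewrite t0 !ge_min !lexx orbT => /(_ isT isT) H1 /(_ isT isT) H2.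
have q0 (U : normedModType R) (f : V * W2 -> U) : t^-1 *: (f (z + t *: (0, 0)) - f z) = 0.
  have -> : (0, 0) = 0 :> V * W2 by [].
  by rewrite scaler0 addr0 subrr scaler0.
have := @robust_cone_quotient F G a p l c z t t0 cone.
move=> /(_ 0 (x' - x) 0 (y' - y) (s + a * e)).
rewrite !q0 !subr0 => /(_ (addr_ge0 s0 (mulr_ge0 a0 (ltW e0)))) [|A B].
  rewrite (le_trans xx) // [s + _]addrC addrA lerD2r -mulrDr ler_wpM2l //.
  rewrite -lerBlDl (le_trans _ H2) // distrC (le_trans _ (ler_dist_dist _ _)) ?ler_norm //.
have E (U : normedModType R) (k : R) (Q D : U) :
    `|Q| <= k * `|y' - y| + c * (s + a * e) -> `|Q - D| <= e ->
    `|D| <= k * `|y' - y| + c * s + e * (1 + c * a + 1).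
  move=> Qle QD; have := ler_normB Q (Q - D); rewrite subKr; nra.
by split; [apply: E A H1|apply: E B H2].
Qed.

End RobustCone.

(** * Contraction along orbits *)

Section GapData.
Context {R : realType} {M : Type} (X Y : banach_bundle R M) (u : M -> M).
Variables (F : forall m, X m * Y (u m) -> X (u m))
          (G : forall m, X m * Y (u m) -> Y m).

(* Common form of the settings (I) and (II): [Gam m] is the set of apertures
   of the horizontal cones over [m] that are mapped into the cone of aperture
   [p m].  Either the latter is again admissible, or only the degenerate cone
   is and [th] pays for the return to it. *)
Record gap_data (q C : R) (Gam : M -> R -> Prop) (p th b ls lu : M -> R) :
    Prop := GapData {
  gd_q : 0 <= q < 1;
  gd_C : 0 <= C;
  gd_b : forall m, 0 <= b m <= C;
  gd_ls : forall m, 0 <= ls m <= C;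
  gd_lu : forall m, 0 <= lu m <= C;
  gd_p : forall m, 0 <= p m <= C;
  gd_pb : forall m, p m * b (u m) <= q;
  gd_Gam : forall m a, Gam m a -> 0 <= a <= C /\ a * b m <= q;
  gd_Gam0 : forall m, Gam m 0;
  gd_cone : forall m a, Gam m a ->
    robust_cone (@F m) (@G m) a (p m) (lu m) (C / (1 - q));
  gd_next : (forall m, Gam (u m) (p m)) \/
    ((forall m a, Gam m a -> a = 0) /\
     (forall m, th m = (1 - p m * b (u m))^-1));
  gd_th : forall m, 1 <= th m <= (1 - q)^-1;
  gd_rate : forall m, th m * ls m * lu m <= q }.

(** Two points of the graph with the same [y] satisfy the premise of (B) trivially, so (B) contains
    the Lipschitz bounds in the first variable. *)
Lemma condB_lipschitz beta beta' ls m : condB F G beta beta' ls ->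
  0 <= beta m -> forall x x' y,
  `|@F m (x', y) - @F m (x, y)| <= ls m * `|x' - x| /\
  `|@G m (x', y) - @G m (x, y)| <= beta' m * `|x' - x|.
Proof.
move=> cB b0 x x' y.
have gr z : @Graph _ _ _ _ _ F G m ((z, @G m (z, y)), (@F m (z, y), y)) by [].
have [] := cB m _ _ _ _ _ _ _ _ (gr x') (gr x); last by split.
by rewrite subrr normr0 mulr_ge0.
Qed.

Lemma spectral_gap_data (L : local_metrics R M) (m0 : M) (eps C q : R)
    (alpha alpha' beta beta' lu ls theta : M -> R) : q < 1 ->
  spectral_setting F G L eps C q alpha alpha' beta beta' lu ls theta ->
  exists Gam p, gap_data q C Gam p theta beta' ls lu.
Proof.
move=> q1 [set12 [[aC _] [bC _] [b'C _] [luC _] [lsC _]] rate].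
have C0 : 0 <= C by case/andP: (aC m0); exact: le_trans.
have ge0 (g : M -> R) : (forall m, 0 <= g m <= C) -> forall m, 0 <= g m.
  by move=> gC m; case/andP: (gC m).
have leC (g : M -> R) : (forall m, 0 <= g m <= C) -> forall m, g m <= C.
  by move=> gC m; case/andP: (gC m).
have q1' : 0 < 1 - q by rewrite subr_gt0.
case: set12 => [[cA cB abq b'b thE]|[[cA [a'C _]] cB abq a'b'b th1]].
- have q0 : 0 <= q by rewrite (le_trans _ (abq m0)) // mulr_ge0 // ge0.
  (* Setting (I): (A') compares points with a common first argument, which is the cone of aperture
     0; its image lies in the cone of aperture [alpha]. *)
  exists (fun m a => a = 0), alpha; split => //; first by rewrite q0.
  + by move=> m a ->; rewrite lexx C0 mul0r.
  + move=> m a ->; apply: (@robust_cone_exact _ _ _ _ _ _ _ 0 (beta' m) _ _ (ls m) q) => //.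
    * by rewrite mul0r.
    * exact: leC.
    * exact: leC.
    * by move=> x x' y; have [] := condB_lipschitz cB (ge0 _ bC m) x x' y.
    * by move=> x x' y; have [] := condB_lipschitz cB (ge0 _ bC m) x x' y.
    * move=> x x' y y'; rewrite mul0r normr_le0 subr_eq0 => /eqP ->.
      by have [/lipschitzP F1 /lipschitzP G1] := cA m x; split; [exact: F1|exact: G1].
  + by right.
  + move=> m; rewrite thE.
    have D : 0 < 1 - alpha m * beta' (u m) by rewrite subr_gt0 (le_lt_trans (abq m)).
    rewrite lef_pV2 ?posrE // lerD2l lerN2 abq andbT.
    by rewrite -[leLHS]invr1 lef_pV2 ?posrE // gerBl mulr_ge0 // ge0.
- have q0 : 0 <= q by rewrite (le_trans _ (abq m0)) // mulr_ge0 // ge0.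
  (* Setting (II): the product [alpha * beta'] is not assumed below 1, so [a * beta' m <= q] is
     imposed separately. The image aperture [alpha' m] satisfies both requirements over [u m]. *)
  exists (fun m a => 0 <= a <= alpha m /\ a * beta' m <= q), alpha'; split => //.
  + by rewrite q0.
  + move=> m a [/andP[-> aa] ->]; rewrite (le_trans aa) //; exact: leC.
  + by move=> m; rewrite lexx mul0r q0 ge0.
  + move=> m a [/andP[a0 aa] abm].
    apply: (@robust_cone_exact _ _ _ _ _ _ _ a (beta' m) _ _ (ls m) q) => //.
    * exact: leC.
    * exact: leC.
    * by move=> x x' y; have [] := condB_lipschitz cB (ge0 _ bC m) x x' y.
    * by move=> x x' y; have [] := condB_lipschitz cB (ge0 _ bC m) x x' y.
    * move=> x x' y y' xx.
      have gr z w : @Graph _ _ _ _ _ F G m ((z, @G m (z, w)), (@F m (z, w), w)) by [].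
      have [] := cA m _ _ _ _ _ _ _ _ (gr x' y') (gr x y); last by split.
      by rewrite (le_trans xx) // ler_wpM2r.
  + left=> m; have [a'a _] := a'b'b m; rewrite a'a ge0 //; split=> //.
  + by move=> m; rewrite th1 lexx -[leLHS]invr1 lef_pV2 ?posrE // gerBl.
Qed.

Section Chain.
Context {q C : R} {Gam : M -> R -> Prop} {p th b ls lu : M -> R}.
Variable gd : gap_data q C Gam p th b ls lu.
Context {J T : Type} (s : J -> J) (E : J -> set_system T).
Variables (sg rs : T -> T) (mu : T -> M) (nx ny rho l : T -> R).
Variables (q2 k0 : R).

(** Here [J] indexes reference points and [E j] describes configurations near the reference [j];
    [sg] advances a configuration by one step of the orbit, and [rs] resets its argument discrepancy
    to zero. [nx] and [ny] are the discrepancies of arguments and values, [rho] the size. The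
    threshold [d] may depend on [j]. *)
Definition chain_bound (k : R) := forall j r e, 0 <= r -> 0 < e ->
  exists2 d : R, 0 < d & \forall t \near E j, forall a, Gam (mu t) a ->
    rho t <= r -> nx t <= a * ny t + d -> ny t <= k * rho t + e.

Hypotheses (FE : forall j, Filter (E j)).
Hypotheses (mu_sg : forall t, mu (sg t) = u (mu t)).
Hypotheses (mu_rs : forall t, mu (rs t) = mu t).
Hypotheses (E_sg : forall j A, E (s j) A -> E j (sg @^-1` A)).
Hypotheses (E_rs : forall j A, E j A -> E j (rs @^-1` A)).
Hypotheses (nx_rs : forall t, nx (rs t) <= 0).
Hypotheses (rho_rs : forall t, rho (rs t) <= rho t).
Hypotheses (ny_rs : forall j, \forall t \near E j,
  ny t <= ny (rs t) + b (mu t) * nx t).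
Hypotheses (q2_01 : 0 <= q2 < 1) (k0_ge0 : 0 <= k0).
Hypotheses (l_bd : forall t, 0 <= l t <= C) (rho_ge0 : forall t, 0 <= rho t).
Hypotheses (rho_sg : forall j, \forall t \near E j, rho (sg t) <= l t * rho t).
Hypotheses (rate : forall j, \forall t \near E j,
  th (mu t) * l t * lu (mu t) <= q2).
Hypotheses (base : chain_bound k0).
Hypotheses (step : forall j r e, 0 <= r -> 0 < e ->
  exists2 d : R, 0 < d & \forall t \near E j, forall a, Gam (mu t) a ->
    rho t <= r -> nx t <= a * ny t + d ->
    nx (sg t) <= p (mu t) * ny (sg t) + e /\
    ny t <= lu (mu t) * ny (sg t) + e).

Let Th := (1 - q)^-1.

Let Th_gt0 : 0 < Th.
Proof. by rewrite invr_gt0 subr_gt0; case/andP: (gd_q gd). Qed.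

Let CT_ge0 : 0 <= C * Th.
Proof. by rewrite mulr_ge0 ?(gd_C gd) // ltW. Qed.

Let chain_bound_next k : 0 <= k -> chain_bound k -> forall j r e,
  0 <= r -> 0 < e ->
  exists2 d : R, 0 < d & \forall t \near E j, forall a, Gam (mu t) a ->
    rho t <= r -> nx t <= a * ny t + d ->
    [/\ nx (sg t) <= p (mu t) * ny (sg t) + e,
      ny t <= lu (mu t) * ny (sg t) + e &
      ny (sg t) <= th (mu t) * (k * rho (sg t) + e)].
Proof.
move=> k1 Sk j r e r0 e0.
have /andP[q0 q1] := gd_q gd; have C0 := gd_C gd.
have r2 : 0 <= C * r by rewrite mulr_ge0.
have e20 : 0 < e / 2 by rewrite divr_gt0.
have C1 : 0 < C + 1 by rewrite ltr_wpDl.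
have [d2 d20 H] := Sk (s j) _ _ r2 e20.
(* The next bound tolerates a cone defect up to [d2]; the second term leaves room both for [e']
   itself and for [b * e'], with [b <= C]. *)
pose e' := Num.min d2 (e / (2 * (C + 1))).
have e'0 : 0 < e' by rewrite lt_min d20 divr_gt0 // mulr_gt0.
have e'd : e' <= d2 by rewrite ge_min lexx.
have e'e : e' * (2 * (C + 1)) <= e.
  by rewrite -ler_pdivlMr ?mulr_gt0 // ge_min lexx orbT.
have e'C : e' * 2 + C * e' * 2 <= e by move: e'e; lra.
have Ce'0 : 0 <= C * e' := mulr_ge0 C0 (ltW e'0).
have [d d0 St] := step j r0 e'0; exists d => //.
have H1 := E_sg H; have H2 := E_sg (E_rs H); have H3 := E_sg (ny_rs (s j)).
near=> t => a Ga rt nxt.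
have A : forall a, Gam (mu (sg t)) a -> rho (sg t) <= C * r ->
    nx (sg t) <= a * ny (sg t) + d2 -> ny (sg t) <= k * rho (sg t) + e / 2.
  by near: t; exact: H1.
have B : forall a, Gam (mu (rs (sg t))) a -> rho (rs (sg t)) <= C * r ->
    nx (rs (sg t)) <= a * ny (rs (sg t)) + d2 ->
    ny (rs (sg t)) <= k * rho (rs (sg t)) + e / 2.
  by near: t; exact: H2.
have D : ny (sg t) <= ny (rs (sg t)) + b (mu (sg t)) * nx (sg t).
  by near: t; exact: H3.
have [S1 S2] : nx (sg t) <= p (mu t) * ny (sg t) + e' /\
    ny t <= lu (mu t) * ny (sg t) + e'.
  by apply: (near St t _ a) => //; near: t.
have rt2 : rho (sg t) <= C * r.
  have rs1 : rho (sg t) <= l t * rho t by near: t; exact: rho_sg.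
  by have /andP[l0 lC] := l_bd t; rewrite (le_trans rs1) // ler_pM.
have /andP[th1 thT] := gd_th gd (mu t).
have th0 : 0 <= th (mu t) by rewrite (le_trans _ th1).
have krl : 0 <= k * rho (sg t) by rewrite mulr_ge0.
have krs : k * rho (rs (sg t)) <= k * rho (sg t) by rewrite ler_wpM2l.
have e'e1 : e' <= e by lra.
have KE : k * rho (sg t) + e / 2 + C * e' <= k * rho (sg t) + e by lra.
split.
- by rewrite (le_trans S1) // lerD2l.
- by rewrite (le_trans S2) // lerD2l.
have [nxt1|[Gam0 thE]] := gd_next gd.
  have := A _ _ rt2 (le_trans S1 _); rewrite mu_sg => /(_ _ (nxt1 _)).
  rewrite lerD2l => /(_ e'd) nyk.
  rewrite (le_trans nyk) // (le_trans _ (ler_peMl _ th1)) //; last first.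
    by rewrite addr_ge0 // ltW.
  by rewrite (le_trans _ KE) // lerDl.
(* The image cone is not admissible here. The reset configuration lies in the cone of aperture 0, so
   the bound applies to it, and the return costs [b * nx (sg t)], where
   [nx (sg t) <= p * ny (sg t) + e']. Moving [p * b * ny (sg t)] to the left and dividing by
   [1 - p * b] produces the factor [th]. *)
have bE := thE (mu t).
have pb := gd_pb gd (mu t).
have den : 0 < 1 - p (mu t) * b (u (mu t)) by rewrite subr_gt0 (le_lt_trans pb).
rewrite bE mulrC ler_pdivlMr // mulrBr mulr1 lerBlDr.
have := B 0; rewrite mu_rs mul0r add0r => /(_ (gd_Gam0 gd _)) B0.
have {B0} B0 := B0 (le_trans (rho_rs _) rt2) (le_trans (nx_rs _) (ltW d20)).
rewrite mu_sg in D; have /andP[b0 bC] := gd_b gd (u (mu t)).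
have := ler_wpM2l b0 S1; have := ler_wpM2r (ltW e'0) bC.
by move: D B0 KE krs; lra.
Unshelve. all: by end_near.
Qed.

Let chain_bound_step k : 0 <= k -> chain_bound k -> chain_bound (q2 * k).
Proof.
move=> k1 Sk j r e r0 e0.
(* The error of the next bound is multiplied by [lu * th <= C * Th], and the present step adds one
   more error. *)
have K0 : 0 < C * Th + 1 by rewrite ltr_wpDl.
have e10 : 0 < e / (C * Th + 1) by rewrite divr_gt0.
have eE : e / (C * Th + 1) * (C * Th + 1) = e by rewrite divfK // gt_eqF.
have [d d0 H] := chain_bound_next k1 Sk j r0 e10.
exists d => //; move: H; apply: filterS3 (rate j) (rho_sg j) => t ra rs1 H a Ga rt nxt.
have [_ S2 nyZ] := H a Ga rt nxt.
set e1 := e / _ in e10 eE S2 nyZ.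
have /andP[th1 thT] := gd_th gd (mu t).
have th0 : 0 <= th (mu t) by rewrite (le_trans _ th1).
have /andP[lu0 luC] := gd_lu gd (mu t).
have T1 := ler_wpM2l lu0 nyZ.
have T0 : lu (mu t) * th (mu t) * k * rho (sg t) <=
    lu (mu t) * th (mu t) * k * (l t * rho t) by rewrite ler_wpM2l // !mulr_ge0.
have T2 : k * rho t * (th (mu t) * l t * lu (mu t)) <= k * rho t * q2.
  by rewrite ler_wpM2l // mulr_ge0.
have T4 : lu (mu t) * th (mu t) * e1 <= C * Th * e1.
  by rewrite ler_wpM2r ?(ltW e10) // ler_pM.
by rewrite (le_trans S2) //; move: T0 T1 T2 T4 eE; lra.
Qed.

(** Each improvement shrinks the thresholds and the neighborhoods, but for given [r] and [e] a
    finite power of [q2] is enough. *)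
Let chain_bound_small r e : 0 <= r -> 0 < e ->
  exists k, [/\ 0 <= k, chain_bound k & k * r <= e].
Proof.
move=> r0 e0; have /andP[q20 q21] := q2_01.
have Sn n : 0 <= q2 ^+ n * k0 /\ chain_bound (q2 ^+ n * k0).
  elim: n => [|n [IH0 IH]]; first by rewrite mul1r.
  rewrite exprS -mulrA; split; first by rewrite mulr_ge0.
  exact: chain_bound_step.
have [n qn] : exists n, q2 ^+ n * (k0 * r) <= e.
  have qk : q2 ^+ n * (k0 * r) @[n --> \oo] --> (0 * (k0 * r) : R).
    by apply: cvgMl; apply: cvg_expr; rewrite ger0_norm.
  have : \forall n \near \oo, q2 ^+ n * (k0 * r) <= e.
    by apply: (@cvgr_le _ _ _ _ _ _ qk); rewrite mul0r.
  by case=> N _ HN; exists N; apply: HN => /=.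
by have [S1 S2] := Sn n; exists (q2 ^+ n * k0); rewrite -mulrA.
Qed.

Lemma gap_chain j r e : 0 <= r -> 0 < e ->
  exists2 d : R, 0 < d & \forall t \near E j,
    rho t <= r -> nx t <= d -> ny t <= e.
Proof.
move=> r0 e0; have e20 : 0 < e / 2 by rewrite divr_gt0.
have [k [k1 Sk kr]] := chain_bound_small r0 e20.
have [d d0 H] := Sk j _ _ r0 e20.
exists d => //; apply: filterS H => t H rt nd.
have := H 0 (gd_Gam0 gd _) rt; rewrite mul0r add0r => /(_ nd) /le_trans; apply.
by rewrite [leRHS]splitr lerD2r (le_trans _ kr) // ler_wpM2l.
Qed.

(** The argument discrepancy one step later is the discrepancy of the values of [xm]; this version
    therefore gives for [xm] what [gap_chain] gives for [f]. *)
Lemma gap_chain_next j r e : 0 <= r -> 0 < e ->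
  exists2 d : R, 0 < d & \forall t \near E j,
    rho t <= r -> nx t <= d -> nx (sg t) <= e.
Proof.
move=> r0 e0; have K0 : 0 < 2 * (C * Th) + 1 by rewrite ltr_wpDl // mulr_ge0.
(* Both [k * rho (sg t)] and the error of the bound are at most [e1], and [p * th <= C * Th]; one
   more [e1] comes from the step. *)
pose e1 := e / (2 * (C * Th) + 1); have e10 : 0 < e1 by rewrite divr_gt0.
have eE : e1 * (2 * (C * Th) + 1) = e by rewrite divfK // gt_eqF.
have [k [k1 Sk kr]] := chain_bound_small (mulr_ge0 (gd_C gd) r0) e10.
have [d d0 H] := chain_bound_next k1 Sk j r0 e10.
exists d => //; move: H; apply: filterS2 (rho_sg j) => t rs1 H rt nd.
have := H 0 (gd_Gam0 gd _) rt; rewrite mul0r add0r => /(_ nd) [S1 _ S3].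
have rt2 : rho (sg t) <= C * r.
  by have /andP[l0 lC] := l_bd t; rewrite (le_trans rs1) // ler_pM.
have /andP[p0 pC] := gd_p gd (mu t); have /andP[th1 thT] := gd_th gd (mu t).
have th0 : 0 <= th (mu t) by rewrite (le_trans _ th1).
rewrite (le_trans S1) // (le_trans (lerD (ler_wpM2l p0 S3) (lexx _))) //.
have : p (mu t) * th (mu t) * (k * rho (sg t) + e1) <= C * Th * (e1 + e1).
  rewrite ler_pM ?lerD2r //; first by rewrite mulr_ge0.
  - by rewrite addr_ge0 ?(ltW e10) // mulr_ge0.
  - by rewrite ler_pM.
  by rewrite (le_trans _ kr) // ler_wpM2l.
by move: eE; lra.
Qed.

End Chain.
End GapData.

(** * Differentiability of the invariant map *)

Section Differentiability.
Context {R : realType} {M : Type} (X Y : banach_bundle R M) (u : M -> M).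
Variables (F : forall m, X m * Y (u m) -> X (u m))
          (G : forall m, X m * Y (u m) -> Y m).
Context {q C : R} {Gam : M -> R -> Prop} {p th b ls lu : M -> R}.
Variable gd : gap_data F G q C Gam p th b ls lu.
Variables (f : forall m, X m -> Y m) (xm : forall m, X m -> X (u m)).
Arguments f : clear implicits.
Arguments xm : clear implicits.
Hypotheses (f_lip : forall m x y, `|f m x - f m y| <= b m * `|x - y|).
Hypotheses (xm_lip : forall m x y, `|xm m x - xm m y| <= ls m * `|x - y|).
Hypotheses (fixF : forall m x, @F m (x, f (u m) (xm m x)) = xm m x).
Hypotheses (fixG : forall m x, @G m (x, f (u m) (xm m x)) = f m x).

(** Inserting the cone inequality into a Lipschitz bound leaves [(1 - a * b') * ny] on the left.
    This provides the starting constant of each iteration. *)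
Lemma apriori_bound (a b' nx ny K d : R) : 0 <= b' <= C -> a * b' <= q ->
  0 <= ny -> 0 <= d -> ny <= b' * nx + K -> nx <= a * ny + d ->
  ny <= (K + C * d) / (1 - q).
Proof.
move=> /andP[b0 bC] abq ny0 d0 nyK nxd; have /andP[q0 q1] := gd_q gd.
rewrite ler_pdivlMr ?subr_gt0 //.
have := ler_wpM2l b0 nxd; have := ler_wpM2r d0 bC; have := ler_wpM2r ny0 abq.
by move: nyK; lra.
Qed.

(** The left side is the error of [robust_cone_approx] when its [d] and [e] are both
    [e / (c * (1 + C) + 1)]. *)
Lemma step_error (c a e : R) : 0 <= c -> 0 <= a <= C -> 0 < e ->
  c * (e / (c * (1 + C) + 1) + a * (e / (c * (1 + C) + 1))) +
    e / (c * (1 + C) + 1) <= e.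
Proof.
move=> c0 /andP[a0 aC] e0; set e1 := e / _; have C0 := gd_C gd.
have K0 : 0 < c * (1 + C) + 1 by rewrite ltr_wpDl // mulr_ge0 // addr_ge0.
have e10 : 0 <= e1 by rewrite divr_ge0 // ltW.
have : e1 * (c * (1 + C) + 1) = e by rewrite divfK // gt_eqF.
by have := ler_wpM2l c0 (ler_wpM2r e10 aC); lra.
Qed.

Let quot_f m (x : X m) (t : R) (v : X m) : Y m :=
  t^-1 *: (f m (x + t *: v) - f m x).
Let quot_x m (x : X m) (t : R) (v : X m) : X (u m) :=
  t^-1 *: (xm m (x + t *: v) - xm m x).

Let quot_lip (V W : normedModType R) (g : V -> W) (k : R) x t v w : 0 < t ->
  (forall x y, `|g x - g y| <= k * `|x - y|) ->
  `|t^-1 *: (g (x + t *: v) - g x) - t^-1 *: (g (x + t *: w) - g x)| <=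
    k * `|v - w|.
Proof.
move=> t0 gk; rewrite -scalerBr normrZ gtr0_norm ?invr_gt0 // ler_pdivrMl //.
have -> : g (x + t *: v) - g x - (g (x + t *: w) - g x) =
  g (x + t *: v) - g (x + t *: w) by lmod R.
rewrite (le_trans (gk _ _)) //.
have -> : x + t *: v - (x + t *: w) = t *: (v - w) by lmod R.
by rewrite normrZ gtr0_norm // mulrCA.
Qed.

Let quot_fix m (x : X m) t v : 0 < t ->
  let y := f (u m) (xm m x) in
  let w := (v, quot_f (xm m x) t (quot_x x t v)) in
  t^-1 *: (@F m ((x, y) + t *: w) - @F m (x, y)) = quot_x x t v /\
  t^-1 *: (@G m ((x, y) + t *: w) - @G m (x, y)) = quot_f x t v.
Proof.
move=> t0 y w.
have -> : (x, y) + t *: w = (x + t *: v, f (u m) (xm m (x + t *: v))).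
  congr pair; rewrite /= /quot_f /quot_x /y !scalerA divff ?gt_eqF // !scale1r.
  by rewrite ![_ + (_ - _)]addrC !subrK.
by rewrite !fixF !fixG.
Qed.

(** There are three independent steps because [differentiable_defect] compares quotients at
    unrelated steps. Moving along the orbit keeps the steps and replaces the increments by quotients
    of [xm]. As [xm] is not known to be additive in the limit, [qc_v] is kept apart from
    [qc_v1 + qc_v2], and [nx] records the difference. *)
Record quotient_config := QuotientConfig {
  qc_pt : total_space X;
  qc_t : R; qc_t1 : R; qc_t2 : R;
  qc_v : X (base qc_pt); qc_v1 : X (base qc_pt); qc_v2 : X (base qc_pt) }.

Let next_pt (j : total_space X) := Pt X (u (base j)) (xm (base j) (vec j)).
Let sg (c : quotient_config) := @QuotientConfig (next_pt (qc_pt c))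
  (qc_t c) (qc_t1 c) (qc_t2 c)
  (quot_x (vec (qc_pt c)) (qc_t c) (qc_v c))
  (quot_x (vec (qc_pt c)) (qc_t1 c) (qc_v1 c))
  (quot_x (vec (qc_pt c)) (qc_t2 c) (qc_v2 c)).
Let rs (c : quotient_config) := @QuotientConfig (qc_pt c)
  (qc_t c) (qc_t1 c) (qc_t2 c) (qc_v1 c + qc_v2 c) (qc_v1 c) (qc_v2 c).
Let E (j : total_space X) : set_system quotient_config := fun A =>
  exists2 d : R, 0 < d & forall t t1 t2 v v1 v2,
    0 < t <= d -> 0 < t1 <= d -> 0 < t2 <= d ->
    A (@QuotientConfig j t t1 t2 v v1 v2).

Let nx (c : quotient_config) : R := `|qc_v c - (qc_v1 c + qc_v2 c)|.
Let quotf (c : quotient_config) (t : R) v : Y (base (qc_pt c)) :=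
  quot_f (vec (qc_pt c)) t v.
Let ny (c : quotient_config) : R := `|quotf (qc_t c) (qc_v c) -
  (quotf (qc_t1 c) (qc_v1 c) + quotf (qc_t2 c) (qc_v2 c))|.
Let rho (c : quotient_config) : R := `|qc_v1 c| + `|qc_v2 c|.

Let E_filter j : Filter (E j).
Proof.
split; first by exists 1.
- move=> A B [d d0 Ad] [d' d'0 Bd]; exists (Num.min d d').
    by rewrite lt_min d0.
  move=> t t1 t2 v v1 v2; rewrite !le_min.
  move=> /and3P[t0 td td'] /and3P[t10 t1d t1d'] /and3P[t20 t2d t2d'].
  by split; [apply: Ad|apply: Bd]; apply/andP.
- move=> A B AB [d d0 Ad]; exists d => // t t1 t2 v v1 v2 H1 H2 H3.
  exact/AB/Ad.
Qed.

Let quot0 (V W : normedModType R) (g : V -> W) (x : V) (t : R) :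
  t^-1 *: (g (x + t *: 0) - g x) = 0.
Proof. by rewrite scaler0 addr0 subrr scaler0. Qed.

Let quot_f_le m (x : X m) t v : 0 < t -> `|quot_f x t v| <= b m * `|v|.
Proof.
move=> t0; have := quot_lip x v 0 t0 (@f_lip m); rewrite quot0 !subr0; exact.
Qed.

Let quot_x_le m (x : X m) t v : 0 < t -> `|quot_x x t v| <= ls m * `|v|.
Proof.
move=> t0; have := quot_lip x v 0 t0 (@xm_lip m); rewrite quot0 !subr0; exact.
Qed.

Hypotheses (dF : forall m z, differentiable (@F m) z).
Hypotheses (dG : forall m z, differentiable (@G m) z).

Let c := C / (1 - q).
Let c_ge0 : 0 <= c.
Proof.
by rewrite divr_ge0 ?(gd_C gd) // subr_ge0; case/andP: (gd_q gd) => _ /ltW.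
Qed.

Let quot_add (V W : normedModType R) (g : V -> W) (z : V) (r e : R) :
  differentiable g z -> 0 < e ->
  exists2 d : R, 0 < d & forall t t1 t2 w1 w2,
    0 < t <= d -> 0 < t1 <= d -> 0 < t2 <= d ->
    `|w1| <= r -> `|w2| <= r -> `|w1 + w2| <= r ->
    `|t^-1 *: (g (z + t *: (w1 + w2)) - g z) -
      (t1^-1 *: (g (z + t1 *: w1) - g z) + t2^-1 *: (g (z + t2 *: w2) - g z))|
      <= e.
Proof.
move=> dg e0; have e30 : 0 < e / 3 by rewrite divr_gt0.
have [d d0 H] := diff_quotient_le r dg e30.
exists d => // t t1 t2 w1 w2 td t1d t2d w1r w2r wr.
have A := H _ _ td wr; have B := H _ _ t1d w1r; have D := H _ _ t2d w2r.
have gD : 'd g z (w1 + w2) = 'd g z w1 + 'd g z w2 by rewrite linearD.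
rewrite gD in A; move: A B D.
set a := t^-1 *: _; set a1 := t1^-1 *: _; set a2 := t2^-1 *: _.
set l1 := 'd _ _ _; set l2 := 'd _ _ _ => A B D.
have -> : a - (a1 + a2) = (a - (l1 + l2)) - ((a1 - l1) + (a2 - l2)) by lmod R.
rewrite (le_trans (ler_normB _ _)) //.
have := ler_normD (a1 - l1) (a2 - l2); move: A B D; lra.
Qed.

Let gap_quotient : forall j r e, 0 <= r -> 0 < e ->
  (exists2 d : R, 0 < d & \forall t \near E j,
    rho t <= r -> nx t <= d -> ny t <= e) /\
  (exists2 d : R, 0 < d & \forall t \near E j,
    rho t <= r -> nx t <= d -> nx (sg t) <= e).
Proof.
have /andP[q0 q1] := gd_q gd; have C0 := gd_C gd.
have q1' : 0 < 1 - q by rewrite subr_gt0.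
have h1 t : base (qc_pt (sg t)) = u (base (qc_pt t)) by [].
have h2 t : base (qc_pt (rs t)) = base (qc_pt t) by [].
have h3 j A : E (next_pt j) A -> E j (sg @^-1` A).
  by case=> d d0 H; exists d => // *; exact: H.
have h4 j A : E j A -> E j (rs @^-1` A).
  by case=> d d0 H; exists d => // *; exact: H.
have h5 t : nx (rs t) <= 0 by rewrite /nx /= subrr normr0.
have h6 t : rho (rs t) <= rho t by [].
have h7 j : \forall t \near E j,
    ny t <= ny (rs t) + b (base (qc_pt t)) * nx t.
  exists 1 => // t t1 t2 v v1 v2 /andP[t0 _] _ _; rewrite /ny /nx /quotf /=.
  rewrite [leRHS]addrC (le_trans (ler_distD (quot_f (vec j) t (v1 + v2)) _ _)) // lerD2r.
  exact: quot_lip.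
have h9 t : 0 <= ny t by exact: normr_ge0.
have k0 : 0 <= 2 * C / (1 - q) by rewrite divr_ge0 ?mulr_ge0 // ltW.
have h10 t := gd_ls gd (base (qc_pt t)).
have h10' t : 0 <= rho t by rewrite addr_ge0.
have h11 j : \forall t \near E j, rho (sg t) <= ls (base (qc_pt t)) * rho t.
  exists 1 => // t t1 t2 v v1 v2 _ /andP[t10 _] /andP[t20 _].
  by rewrite /rho /= mulrDr lerD // quot_x_le.
have h12 j : \forall t \near E j,
    th (base (qc_pt t)) * ls (base (qc_pt t)) * lu (base (qc_pt t)) <= q.
  by exists 1 => // *; exact: gd_rate gd _.
(* Starting bound: once [v] is replaced by [v1 + v2], at the cost [b * nx], each quotient is at most
   [C] times its increment, which gives [2 * C * rho]. *)
have h13 : @chain_bound _ _ Gam _ _ E (fun t => base (qc_pt t)) nx ny rho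
    (2 * C / (1 - q)).
  move=> j r e r0 e0; have C1 : 0 < C + 1 by rewrite ltr_wpDl.
  pose d := e * (1 - q) / (C + 1).
  have d0 : 0 < d by rewrite divr_gt0 // mulr_gt0.
  have dE : d * (C + 1) = e * (1 - q) by rewrite divfK // gt_eqF.
  exists d => //; exists 1 => // t t1 t2 v v1 v2 /andP[t0 _] /andP[t10 _] /andP[t20 _].
  move=> a /(gd_Gam gd)[/andP[a0 aC] abq] rt nxt.
  have bb := gd_b gd (base j); have /andP[b0 bC] := bb.
  set tt := QuotientConfig _ _ _ _ _ _ in rt nxt *.
  have nyK : ny tt <= b (base j) * nx tt + 2 * C * rho tt.
    rewrite /ny /quotf /= (le_trans (ler_distD (quot_f (vec j) t (v1 + v2)) _ _)) //.
    rewrite lerD //; first exact: quot_lip.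
    rewrite (le_trans (ler_normB _ _)) //.
    have A := quot_f_le (vec j) (v1 + v2) t0.
    have B := ler_normD (quot_f (vec j) t1 v1) (quot_f (vec j) t2 v2).
    have A1 := quot_f_le (vec j) v1 t10; have A2 := quot_f_le (vec j) v2 t20.
    have D := ler_wpM2l b0 (ler_normD v1 v2).
    have bCr : b (base j) * (`|v1| + `|v2|) <= C * (`|v1| + `|v2|) by rewrite ler_wpM2r ?addr_ge0.
    by move: A B A1 A2 D bCr; rewrite !mulrDr; lra.
  have := apriori_bound bb abq (h9 _) (ltW d0) nyK nxt.
  move=> /le_trans; apply; rewrite ler_pdivrMr //.
  have -> : (2 * C / (1 - q) * rho tt + e) * (1 - q) = 2 * C * rho tt + d * (C + 1).
    by rewrite dE; field; rewrite gt_eqF.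
  by rewrite lerD2l mulrC ler_wpM2l ?(ltW d0) // lerDl.
have h14 j r e : 0 <= r -> 0 < e -> exists2 d : R, 0 < d &
    \forall t \near E j, forall a, Gam (base (qc_pt t)) a ->
    rho t <= r -> nx t <= a * ny t + d ->
    nx (sg t) <= p (base (qc_pt t)) * ny (sg t) + e /\
    ny t <= lu (base (qc_pt t)) * ny (sg t) + e.
  move=> r0 e0; pose e1 := e / (c * (1 + C) + 1).
  have e10 : 0 < e1 by rewrite divr_gt0 // ltr_wpDl // mulr_ge0 // addr_ge0.
  case: j => m x.
  pose z := (x, f (u m) (xm m x)).
  (* Bounds the increments of graph points: their second component is a quotient of [f] applied to a
     quotient of [xm], both with Lipschitz constant at most [C]. *)
  pose r1 := r + C * (C * r).
  have [d1 d10 H1] := quot_add r1 (dF z) e10.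
  have [d2 d20 H2] := quot_add r1 (dG z) e10.
  exists e1 => //; exists (Num.min d1 d2); first by rewrite lt_min d10.
  move=> t t1 t2 v v1 v2; rewrite !le_min.
  move=> /and3P[t0 td td'] /and3P[t10 t1d t1d'] /and3P[t20 t2d t2d'] a Ga rt nxt.
  have [/= aC _] := gd_Gam gd Ga; have /andP[a0 _] := aC.
  rewrite /nx /ny /rho /quotf /= in rt nxt *.
  set w := quot_x x t v; set w1 := quot_x x t1 v1; set w2 := quot_x x t2 v2.
  set x1 := xm m x.
  pose y1 := quot_f x1 t1 w1; pose y2 := quot_f x1 t2 w2.
  have [vr1 vr2] : `|v1| <= r /\ `|v2| <= r.
    by split; rewrite (le_trans _ rt) // ?lerDl ?lerDr.
  have yle t' v' : 0 < t' -> `|quot_f x1 t' (quot_x x t' v')| <= C * (C * `|v'|).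
    move=> t'0; rewrite (le_trans (quot_f_le _ _ t'0)) // ler_pM //.
    - by case/andP: (gd_b gd (u m)).
    - by case/andP: (gd_b gd (u m)).
    rewrite (le_trans (quot_x_le _ _ t'0)) // ler_wpM2r //.
    by case/andP: (gd_ls gd m).
  have pr t' v' : 0 < t' -> `|v'| <= r ->
      `|(v', quot_f x1 t' (quot_x x t' v'))| <= r1.
    move=> t'0 v'r; rewrite (le_trans (norm_pair_le _ _)) // lerD //.
    by rewrite (le_trans (yle _ _ t'0)) // !ler_wpM2l.
  have pr12 : `|(v1, y1) + (v2, y2)| <= r1.
    rewrite (le_trans (norm_pair_le _ _)) // lerD //=.
      by rewrite (le_trans (ler_normD _ _)).
    rewrite (le_trans (ler_normD _ _)) // (le_trans (lerD (yle _ _ t10) (yle _ _ t20))) //.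
    by rewrite -!mulrDr !ler_wpM2l.
  have [Fq1 Gq1] := quot_fix x v1 t10; have [Fq2 Gq2] := quot_fix x v2 t20.
  have [Fq Gq] := quot_fix x v t0.
  have {}H1 := H1 t t1 t2 (v1, y1) (v2, y2).
  have {}H2 := H2 t t1 t2 (v1, y1) (v2, y2).
  rewrite t0 t10 t20 td t1d t2d pr // pr // in H1.
  rewrite t0 t10 t20 td' t1d' t2d' pr // pr // in H2.
  have {}H1 := H1 isT isT isT isT isT pr12; have {}H2 := H2 isT isT isT isT isT pr12.
  rewrite Fq1 Fq2 in H1; rewrite Gq1 Gq2 in H2.
  (* The sum of the graph increments for [v1] and [v2] is not itself a graph increment. Asymptotic
     additivity of [F] and [G] sends it close to the sums of the quotients, so it serves as the
     approximate reference for the exact increment [v]. *)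
  have cone := @robust_cone_quotient _ _ _ _ _ _ _ _ _ _ _ z t t0 (gd_cone gd Ga).
  have := robust_cone_approx cone a0 c_ge0 (ltW e10) H1 H2.
  move=> /(_ v (quot_f x1 t w)); rewrite Fq Gq => /(_ nxt) [S1 S2].
  have ee := step_error c_ge0 aC e0.
  by split; [rewrite (le_trans S1)|rewrite (le_trans S2)] => //; rewrite lerD2l.
move=> j r e r0 e0; split.
  exact (@gap_chain _ _ _ _ _ _ _ _ _ _ _ _ _ _ _ gd _ _ _ E sg rs
    (fun t => base (qc_pt t)) nx ny rho (fun t => ls (base (qc_pt t))) _ _
    E_filter
    h1 h2 h3 h4 h5 h6 h7 (gd_q gd) k0 h10 h10' h11 h12 h13 h14 j r e r0 e0).
exact (@gap_chain_next _ _ _ _ _ _ _ _ _ _ _ _ _ _ _ gd _ _ _ E sg rs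
    (fun t => base (qc_pt t)) nx ny rho (fun t => ls (base (qc_pt t))) _ _
    E_filter
    h1 h2 h3 h4 h5 h6 h7 (gd_q gd) k0 h10 h10' h11 h12 h13 h14 j r e r0 e0).
Qed.


Lemma differentiable_invariant m x : differentiable (f m) x /\ differentiable (xm m) x.
Proof.
split.
- apply: (@differentiable_defect _ _ (bfib Y m) (f m) x (b m)).
    by move=> [y z] _; exact: f_lip.
  move=> r e e0.
  have [[d0 d00 [d d1 H]] _] := gap_quotient (Pt X m x) (addr_ge0 (normr_ge0 r) (normr_ge0 r)) e0.
  exists d => // s s1 s2 v1 v2 sd s1d s2d v1r v2r.
  have := H s s1 s2 (v1 + v2) v1 v2 sd s1d s2d; apply.
    by rewrite /rho lerD // (le_trans _ (ler_norm _)).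
  by rewrite /nx /= subrr normr0 ltW.
- apply: (@differentiable_defect _ _ (bfib X (u m)) (xm m) x (ls m)).
    by move=> [y z] _; exact: xm_lip.
  move=> r e e0.
  have [_ [d0 d00 [d d1 H]]] := gap_quotient (Pt X m x) (addr_ge0 (normr_ge0 r) (normr_ge0 r)) e0.
  exists d => // s s1 s2 v1 v2 sd s1d s2d v1r v2r.
  have := H s s1 s2 (v1 + v2) v1 v2 sd s1d s2d; apply.
    by rewrite /rho lerD // (le_trans _ (ler_norm _)).
  by rewrite /nx /= subrr normr0 ltW.
Qed.

End Differentiability.

(** * Comparison of differentials *)

Section DifferentialComparison.
Context {R : realType} {M : Type} (X Y : banach_bundle R M) (u : M -> M).
Variables (F : forall m, X m * Y (u m) -> X (u m))
          (G : forall m, X m * Y (u m) -> Y m).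
Context {q C : R} {Gam : M -> R -> Prop} {p th b ls lu : M -> R}.
Variable gd : gap_data F G q C Gam p th b ls lu.
Variables (f : forall m, X m -> Y m) (xm : forall m, X m -> X (u m)).
Arguments f : clear implicits.
Arguments xm : clear implicits.
Hypotheses (f_lip : forall m x y, `|f m x - f m y| <= b m * `|x - y|).
Hypotheses (xm_lip : forall m x y, `|xm m x - xm m y| <= ls m * `|x - y|).
Hypotheses (fixF : forall m x, @F m (x, f (u m) (xm m x)) = xm m x).
Hypotheses (fixG : forall m x, @G m (x, f (u m) (xm m x)) = f m x).
Hypotheses (dF : forall m z, differentiable (@F m) z).
Hypotheses (dG : forall m z, differentiable (@G m) z).

Let df m x : differentiable (f m) x.
Proof. by have [] := differentiable_invariant gd f_lip xm_lip fixF fixG dF dG x. Qed.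
Let dx m x : differentiable (xm m) x.
Proof. by have [] := differentiable_invariant gd f_lip xm_lip fixF fixG dF dG x. Qed.

Definition graph_pt m (x : X m) : (X m * Y (u m))%type :=
  (x, f (u m) (xm m x)).

Let df_le m x v : `|'d (f m) x v| <= b m * `|v|.
Proof. by apply: diff_lipschitz => // -[y z] _; exact: f_lip. Qed.
Let dx_le m x v : `|'d (xm m) x v| <= ls m * `|v|.
Proof. by apply: diff_lipschitz => // -[y z] _; exact: xm_lip. Qed.

Let diff_graph_pt m x : differentiable (@graph_pt m) x /\
  forall v, 'd (@graph_pt m) x v =
    (v, 'd (f (u m)) (xm m x) ('d (xm m) x v)).
Proof.
have dfx : differentiable (f (u m) \o xm m) x by apply: differentiable_comp.
split; first exact: differentiable_pair.
move=> v; rewrite /graph_pt diff_pair //=.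
have -> : 'd (fun y : X m => y) x = id :> (X m -> X m) by exact: diff_val.
congr pair; have /(congr1 (fun g => g v)) := diff_comp (dx x) (df (xm m x)).
exact.
Qed.

Let diff_fix m x v :
  let w := (v, 'd (f (u m)) (xm m x) ('d (xm m) x v)) in
  'd (@F m) (graph_pt x) w = 'd (xm m) x v /\
  'd (@G m) (graph_pt x) w = 'd (f m) x v.
Proof.
have [dg dgE] := diff_graph_pt x.
have EF : @F m \o @graph_pt m = xm m by apply/funext => y; exact: fixF.
have EG : @G m \o @graph_pt m = f m by apply/funext => y; exact: fixG.
rewrite /= -dgE; split.
  by rewrite -[in RHS]EF (diff_comp dg (dF _)).
by rewrite -[in RHS]EG (diff_comp dg (dG _)).
Qed.

(** The two points may lie over different base points. With suitable identifications [Phi] and [Psi]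
    of the fibers, the same comparison yields continuity across fibers and moduli of continuity
    inside them. *)
Record pair_config := PairConfig {
  pm : M; pm' : M; px : X pm; px' : X pm' }.

Definition next_pair (c : pair_config) : pair_config :=
  PairConfig (xm (pm c) (px c)) (xm (pm' c) (px' c)).

Context {J : Type} (s : J -> J) (P : J -> set_system pair_config).
Variables (Phi : forall c : pair_config, X (pm c) -> X (pm' c))
          (Psi : forall c : pair_config, Y (pm c) -> Y (pm' c)) (q2 : R).
Hypotheses (q2_01 : 0 <= q2 < 1).
Hypotheses (P_filter : forall j, Filter (P j)).
Hypotheses (P_next : forall j A, P (s j) A -> P j (next_pair @^-1` A)).
Hypotheses (rate : forall j, \forall c \near P j,
  th (pm' c) * ls (pm c) * lu (pm' c) <= q2).
Hypotheses (bound : forall j, \forall c \near P j,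
  (forall v, `|Phi (c := c) v| <= 2 * `|v|) /\ (forall v, `|Psi (c := c) v| <= 2 * `|v|)).
Hypotheses (error : forall j e, 0 < e -> \forall c \near P j,
  forall v w,
  `|'d (@F (pm' c)) (graph_pt (px' c)) (Phi (c := c) v, Psi (c := next_pair c) w) -
    Phi (c := next_pair c) ('d (@F (pm c)) (graph_pt (px c)) (v, w))| <= e * (`|v| + `|w|) /\
  `|'d (@G (pm' c)) (graph_pt (px' c)) (Phi (c := c) v, Psi (c := next_pair c) w) -
    Psi (c := c) ('d (@G (pm c)) (graph_pt (px c)) (v, w))| <= e * (`|v| + `|w|)).

(** The second vector is free: [Phi] intertwines the differentials of [xm] only approximately, so
    after one step it is no longer the [Phi]-image of the first. *)
Record diff_config := DiffConfig {
  dp : pair_config; dv : X (pm dp); dv' : X (pm' dp) }.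

Let sg (t : diff_config) := @DiffConfig (next_pair (dp t))
  ('d (xm (pm (dp t))) (px (dp t)) (dv t))
  ('d (xm (pm' (dp t))) (px' (dp t)) (dv' t)).
Let rs (t : diff_config) := @DiffConfig (dp t) (dv t) (Phi (dv t)).
Let E (j : J) : set_system diff_config := fun A =>
  \forall c \near P j, forall v v', A (@DiffConfig c v v').
Let mu (t : diff_config) := pm' (dp t).
Let nx (t : diff_config) : R := `|dv' t - Phi (dv t)|.
Let ny (t : diff_config) : R := `|'d (f (mu t)) (px' (dp t)) (dv' t) -
  Psi ('d (f (pm (dp t))) (px (dp t)) (dv t))|.
Let rho (t : diff_config) : R := `|dv t|.

Let E_filter j : Filter (E j).
Proof.
split; first by rewrite /E; exact: nearW.
- move=> A B EA EB; apply: (@filterS2 _ (P j) _ _ _ _ _ EA EB) => c Ac Bc v v'.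
  by split; [exact: Ac|exact: Bc].
- by move=> A B AB; apply: (@filterS _ (P j)) => c Ac v v'; exact/AB/Ac.
Qed.

Let E_all i A : (forall c v v', A (@DiffConfig c v v')) -> E i A.
Proof. by move=> EA; rewrite /E; apply: nearW => c v v'. Qed.

Let c := C / (1 - q).
Let c_ge0 : 0 <= c.
Proof.
by rewrite divr_ge0 ?(gd_C gd) // subr_ge0; case/andP: (gd_q gd) => _ /ltW.
Qed.

(** The reference vector is carried by the differential of [xm] at [px], hence [ls] at [pm]. The
    cone condition is that of the differentials of [F] and [G] over [px'], hence [th] and [lu] at
    [pm']. The hypothesis [error] makes the transported reference vector an approximate
    configuration over [px']. *)
Lemma differential_comparison j e : 0 < e -> \forall c \near P j,
  forall v, `|v| <= 1 ->
  `|'d (f (pm' c)) (px' c) (Phi (c := c) v) -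
    Psi (c := c) ('d (f (pm c)) (px c) v)| <= e.
Proof.
move=> e0.
have /andP[q0 q1] := gd_q gd; have C0 := gd_C gd.
have q1' : 0 < 1 - q by rewrite subr_gt0.
have h1 t : mu (sg t) = u (mu t) by [].
have h2 t : mu (rs t) = mu t by [].
have h3 i A : E (s i) A -> E i (sg @^-1` A).
  by move=> /P_next; apply: (@filterS _ (P i)) => d H v v'; exact: H.
have h4 i A : E i A -> E i (rs @^-1` A).
  by move=> EA; apply: (@filterS _ (P i) _ _ _ _ EA) => d H v v'; exact: H.
have h5 t : nx (rs t) <= 0 by rewrite /nx /= subrr normr0.
have h6 t : rho (rs t) <= rho t by [].
have h7 i : \forall t \near E i, ny t <= ny (rs t) + b (mu t) * nx t.
  apply: E_all => t v v'; rewrite /ny /nx /= [leRHS]addrC.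
  rewrite (le_trans (ler_distD ('d (f (pm' t)) (px' t) (Phi v)) _ _)) // lerD2r.
  by rewrite -linearB df_le.
(* [Phi] and [Psi] have norm at most 2 and differentials of [f] at most [C]: each of the two values
   compared contributes [2 * C]. *)
have k0 : 0 <= 4 * C / (1 - q) by rewrite divr_ge0 ?mulr_ge0 // ltW.
have h10 t := gd_ls gd (pm (dp t)).
have h10' t : 0 <= rho t by exact: normr_ge0.
have h11 i : \forall t \near E i, rho (sg t) <= ls (pm (dp t)) * rho t.
  by apply: E_all => t v v'; exact: dx_le.
have h12 i : \forall t \near E i, th (mu t) * ls (pm (dp t)) * lu (mu t) <= q2.
  by apply: (@filterS _ (P i) _ _ _ _ (rate i)) => t H v v'; exact: H.
have h13 : @chain_bound _ _ Gam _ _ E mu nx ny rho (4 * C / (1 - q)).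
  move=> i r e' r0 e'0; have C1 : 0 < C + 1 by rewrite ltr_wpDl.
  pose d := e' * (1 - q) / (C + 1).
  have d0 : 0 < d by rewrite divr_gt0 // mulr_gt0.
  have dE : d * (C + 1) = e' * (1 - q) by rewrite divfK // gt_eqF.
  exists d => //; apply: (@filterS _ (P i) _ _ _ _ (bound i)) => pc [Phi2 Psi2] v v' a.
  move=> /(gd_Gam gd)[/andP[a0 aC] abq] rt nxt.
  have bb := gd_b gd (pm' pc); have /andP[b0 bC] := bb.
  have /andP[b1 b1C] := gd_b gd (pm pc).
  set tt := DiffConfig _ _ in rt nxt *.
  have nyK : ny tt <= b (pm' pc) * nx tt + 4 * C * rho tt.
    rewrite /ny /nx /rho /mu /=.
    rewrite (le_trans (ler_distD ('d (f (pm' pc)) (px' pc) (Phi v)) _ _)) //.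
    rewrite lerD //; first by rewrite -linearB df_le.
    rewrite (le_trans (ler_normB _ _)) //.
    have A := df_le (px' pc) (Phi v); have B := Psi2 ('d (f (pm pc)) (px pc) v).
    have D := df_le (px pc) v.
    have A1 : b (pm' pc) * `|Phi v| <= C * (2 * `|v|) by rewrite ler_pM.
    have A2 : b (pm pc) * `|v| <= C * `|v| by rewrite ler_wpM2r.
    by move: A B D A1 A2; lra.
  have := apriori_bound gd bb abq (normr_ge0 _) (ltW d0) nyK nxt.
  move=> /le_trans; apply; rewrite ler_pdivrMr //.
  have -> : (4 * C / (1 - q) * rho tt + e') * (1 - q) = 4 * C * rho tt + d * (C + 1).
    by rewrite dE; field; rewrite gt_eqF.
  by rewrite lerD2l mulrC ler_wpM2l ?(ltW d0) // lerDl.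
have h14 i r e' : 0 <= r -> 0 < e' -> exists2 d : R, 0 < d &
    \forall t \near E i, forall a, Gam (mu t) a ->
    rho t <= r -> nx t <= a * ny t + d ->
    nx (sg t) <= p (mu t) * ny (sg t) + e' /\
    ny t <= lu (mu t) * ny (sg t) + e'.
  move=> r0 e'0; pose e1 := e' / (c * (1 + C) + 1).
  have e10 : 0 < e1 by rewrite divr_gt0 // ltr_wpDl // mulr_ge0 // addr_ge0.
  (* [error] is proportional to the size of the graph vector, which is at most [r + C * (C * r)]
     when [|v| <= r]; the last 1 keeps [K] positive. *)
  pose K := r + C * (C * r) + 1.
  have K0 : 0 < K by rewrite ltr_wpDl // addr_ge0 // !mulr_ge0.
  have eK0 : 0 < e1 / K by rewrite divr_gt0.
  exists e1 => //; apply: (@filterS _ (P i) _ _ _ _ (error i eK0)) => pc H v v' a Ga rt nxt.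
  have [/= aC _] := gd_Gam gd Ga; have /andP[a0 _] := aC.
  rewrite /nx /ny /rho /mu /= in rt nxt *.
  set x1 := xm (pm pc) (px pc); set w := 'd (xm (pm pc)) (px pc) v.
  have vwK : e1 / K * (`|v| + `|'d (f (u (pm pc))) x1 w|) <= e1.
    rewrite mulrAC ler_pdivrMr // ler_wpM2l ?(ltW e10) //.
    have /andP[b0 bC] := gd_b gd (u (pm pc)).
    have /andP[l0 lC] := gd_ls gd (pm pc).
    rewrite /K ler_wpDr // lerD // (le_trans (df_le _ _)) // ler_pM //.
    by rewrite (le_trans (dx_le _ _)) // ler_pM.
  have [E1 E2] := H v ('d (f (u (pm pc))) x1 w).
  have {}E1 := le_trans E1 vwK; have {}E2 := le_trans E2 vwK.
  have [D1 D2] := diff_fix (px pc) v; have [D1' D2'] := diff_fix (px' pc) v'.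
  rewrite /= D1 in E1; rewrite /= D2 in E2.
  have cone := robust_cone_diff a0 c_ge0 (dF (graph_pt (px' pc)))
    (dG (graph_pt (px' pc))) (gd_cone gd Ga).
  have := robust_cone_approx cone a0 c_ge0 (ltW e10) E1 E2.
  set y2' := 'd (f _) (xm _ (px' pc)) ('d (xm _) (px' pc) v') in D1' D2'.
  move=> /(_ v' y2'); rewrite D1' D2' => /(_ nxt) [S1 S2].
  have ee := step_error gd c_ge0 aC e'0.
  by split; [rewrite (le_trans S1)|rewrite (le_trans S2)] => //; rewrite lerD2l.
have [d d0] := @gap_chain _ _ _ _ _ _ _ _ _ _ _ _ _ _ _ gd _ _ _ E sg rs
    mu nx ny rho (fun t => ls (pm (dp t))) _ _ E_filter
    h1 h2 h3 h4 h5 h6 h7 q2_01 k0 h10 h10' h11 h12 h13 h14 j 1 e ler01 e0.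
apply: (@filterS _ (P j)) => pc H v v1.
have := H v (Phi v) v1; apply.
by rewrite /nx /= subrr normr0 ltW.
Qed.

End DifferentialComparison.

(** * Charts of the total space *)

Section TotalSpaceCharts.
Context {R : realType} {M : topologicalType}.

(** Since the topology is final for all charts, the inverse of chart [i] is continuous as soon as
    every transition into it is. The notion covers [X], [Y] and [bprod] alike. *)
Definition regular_chart (B : bundle R M) (i : idx B) : Prop :=
  open (dom B i) /\ forall k m (x : model B k), dom B k m -> dom B i m ->
    {for (m, x), continuous
      (fun q : M * model B k => chartV B i q.1 (chart B k q.1 q.2))}.

Lemma near_dom (U : topologicalType) (D : set M) m (x : U) :
  open D -> D m -> \forall q \near (m, x), D q.1.
Proof.
move=> oD Dm; have : \forall m' \near m, D m' by apply: open_nbhs_nbhs; split.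
by move=> /cvg_fst; apply.
Qed.

Lemma near_chart (B : bundle R M) (i : idx B) m (x : model B i)
    (Q : set (total_space B)) : open (dom B i) -> dom B i m ->
  (\forall p \near chart_map (m, x), Q p) ->
  \forall q \near (m, x), Q (chart_map q).
Proof.
move=> oi im; rewrite {1}/prop_near1 nbhsE => -[U [oU Ux] UQ].
pose D := dom B i `*` [set: model B i].
have Dmx : D (m, x) by [].
have : nbhs ((m, x) : subspace D) (@chart_map _ _ _ i @^-1` U).
  by apply: open_nbhs_nbhs; split=> //; exact: oU.
have -> : nbhs ((m, x) : subspace D) = within D (nbhs (m, x)).
  by rewrite nbhs_subspace_in.
move=> wU.
have {wU} UD : nbhs (m, x) [set q | D q -> U (chart_map q)] := wU.
have iD : nbhs (m, x) [set q | dom B i q.1] := near_dom x oi im.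
have : nbhs (m, x) [set q | Q (chart_map q)].
  by apply: filterS2 UD iD => q qU qi; apply: UQ; apply: qU; split.
by [].
Qed.

Lemma near_total (B : bundle R M) (i : idx B) (p : total_space B)
    (A : set (M * model B i)) :
  (forall k, open (dom B k)) -> regular_chart i -> dom B i (base p) ->
  nbhs (base p, chartV B i (base p) (vec p)) A ->
  \forall p' \near p, dom B i (base p') /\
    A (base p', chartV B i (base p') (vec p')).
Proof.
move=> ok [oi reg] ip Ap.
(* Taking the interior of [A] makes the preimage of [W] in every chart a neighborhood of each of its
   points, so [W] is open in the final topology. *)
pose W := [set p' : total_space B | dom B i (base p') /\
  A^° (base p', chartV B i (base p') (vec p'))].
have oW : total_open W.
  move=> k; rewrite -open_subspaceIT.
  apply: open_subspaceW; rewrite openE => -[m x] [[/= im Am] [/= km _]].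
  have ck := reg k m x km im.
  have cp : {for (m, x), continuous (fun q : M * model B k =>
      (q.1, chartV B i q.1 (chart B k q.1 q.2)))}.
    by apply: cvg_pair => /=; [exact: cvg_fst|exact: ck].
  have Am' : nbhs (m, chartV B i m (chart B k m x)) A^°.
    exact: nbhs_interior.
  have Aq : nbhs (m, x) [set q | A^° (q.1, chartV B i q.1 (chart B k q.1 q.2))].
    exact: cp _ Am'.
  have Dq : nbhs (m, x) [set q | dom B k q.1] := near_dom x (ok k) km.
  have Iq : nbhs (m, x) [set q | dom B i q.1] := near_dom x oi im.
  have : nbhs (m, x) (@chart_map _ _ _ k @^-1` W `&` dom B k `*` [set: model B k]).
    by apply: filterS3 Aq Dq Iq => q Aq Dq Iq; do !split.
  by [].
rewrite /prop_near1 nbhsE; exists W; last by move=> p' [ip' /interior_subset Ap'].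
by split.
Qed.

Lemma near_bmap (A B : bundle R M) (w : M -> M) (H : forall m, A m -> B (w m))
    (i : idx A) (j : idx B) m (x : model A i) (N : set (M * model B j)) :
  (forall k, open (dom A k)) -> (forall k, open (dom B k)) ->
  regular_chart j -> continuous_bmap H -> dom A i m -> dom B j (w m) ->
  nbhs (w m, chartV B j (w m) (H m (chart A i m x))) N ->
  \forall q \near (m, x), dom B j (w q.1) /\
    N (w q.1, chartV B j (w q.1) (H q.1 (chart A i q.1 q.2))).
Proof.
move=> oA oB rj Hc im jm Nn.
have NQ := @near_total B j (Pt B (w m) (H m (chart A i m x))) N oB rj jm Nn.
have := Hc (chart_map (m, x)) _ NQ => HQ.
exact: near_chart (oA i) im HQ.
Qed.

Lemma near_section (B : bundle R M) (sec : forall m, B m) (j : idx B) m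
    (N : set (M * model B j)) :
  (forall k, open (dom B k)) -> regular_chart j -> continuous_section sec ->
  dom B j m -> nbhs (m, chartV B j m (sec m)) N ->
  \forall m' \near m, dom B j m' /\ N (m', chartV B j m' (sec m')).
Proof.
move=> oB rj sc jm Nn.
exact: sc _ _ (@near_total B j (Pt B m (sec m)) N oB rj jm Nn).
Qed.

Lemma within_continuous_at (T U : topologicalType) (D : set T) (g : T -> U) x :
  {within D, continuous g} -> nbhs x D -> {for x, continuous g}.
Proof.
move=> gD Dx; have xD : D x by exact: nbhs_singleton.
have gDx := gD x; move=> A /gDx; rewrite /nbhs /=.
rewrite -nbhs_subspace_in // => wA.
have {}wA : nbhs x [set y | D y -> A (g y)] := wA.
have : nbhs x [set y | A (g y)] by apply: filterS2 wA Dx => y; apply.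
by [].
Qed.

Lemma regular_chart_c1 (X : banach_bundle R M) (m0 : M) :
  C1_topology_bundle X -> @regular_chart X m0.
Proof.
move=> hX; split; first exact: c1_dom_open.
move=> k m x km im;
have : {for (m, x), continuous
    (fun q : M * X k => transition X k m0 q.1 q.2)}; last by [].
refine (@within_continuous_at (M * X k)%type (X m0)
  ((bdom X k `&` bdom X m0) `*` [set: X k]) _ (m, x)
  (@c1_transition_continuous _ _ _ hX k m0) _).
have a1 : nbhs (m, x) [set q | bdom X k q.1] := near_dom x (c1_dom_open hX k) km.
have a2 : nbhs (m, x) [set q | bdom X m0 q.1].
  exact: near_dom x (c1_dom_open hX m0) im.
by apply: filterS2 a1 a2 => -[m' x'] /= a b; do !split.
Qed.

Lemma dom_bprod_open (X Y : banach_bundle R M) (w : M -> M) :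
  C1_topology_bundle X -> C1_topology_bundle Y -> continuous w ->
  forall i, open (dom (bprod X Y w) i).
Proof.
move=> hX hY cw [i j] /=; apply: openI; first exact: c1_dom_open.
by apply: open_comp; [move=> ? _; exact: cw|exact: c1_dom_open].
Qed.

Lemma regular_chart_bprod (X Y : banach_bundle R M) (w : M -> M) m0 m1 :
  C1_topology_bundle X -> C1_topology_bundle Y -> continuous w ->
  @regular_chart (bprod X Y w) (m0, m1).
Proof.
move=> hX hY cw; split; first exact: dom_bprod_open.
move=> [k l] m [x y] [/= km lm] [/= im jm].
have [_ rX] := regular_chart_c1 m0 hX; have [_ rY] := regular_chart_c1 m1 hY.
have cX := rX k m x km im; have cY := rY l (w m) y lm jm.
pose T := (M * (X k * Y l)%type)%type.
have c1 : {for (m, (x, y)), continuous (fun q : T => (q.1, q.2.1))}.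
  apply: cvg_pair; first exact: cvg_fst.
  by apply: (@continuous_comp _ _ _ snd fst); [exact: cvg_snd|exact: cvg_fst].
have c2 : {for (m, (x, y)), continuous (fun q : T => (w q.1, q.2.2))}.
  apply: cvg_pair.
    by apply: (@continuous_comp _ _ _ fst w); [exact: cvg_fst|exact: cw].
  by apply: (@continuous_comp _ _ _ snd snd); exact: cvg_snd.
apply: cvg_pair => /=.
  exact: (@continuous_comp _ _ _ (fun q : T => (q.1, q.2.1)) _ _ c1 cX).
exact: (@continuous_comp _ _ _ (fun q : T => (w q.1, q.2.2)) _ _ c2 cY).
Qed.

End TotalSpaceCharts.

(** * Estimates in charts centered at the reference point *)

Section CenterCharts.
Context {R : realType} {M : topologicalType}.

(** The constant 2 is a convenient number strictly above [1 + eps]. *)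
Definition bilipschitz_near (X : banach_bundle R M) : Prop :=
  forall m, \forall m' \near m, bdom X m m' /\
    (forall x y, `|bchart X m m' x - bchart X m m' y| <= 2 * `|x - y|) /\
    (forall x y, `|bchartV X m m' x - bchartV X m m' y| <= 2 * `|x - y|).

Lemma limf_esup_near (T : choiceType) (U : filteredType T) (g : U -> \bar R)
    (E : set_system U) (a c : R) :
  (limf_esup g E <= a%:E)%E -> a < c ->
  exists2 V, E V & forall x, V x -> (g x <= c%:E)%E.
Proof.
move=> ga ac; have : (limf_esup g E < c%:E)%E by rewrite (le_lt_trans ga) // lte_fin.
move=> /ereal_inf_lt[_ [V EV <-] supV]; exists V => // x Vx.
by rewrite (le_trans _ (ltW supV)) //; apply: ereal_sup_ubound; exists x.
Qed.

Lemma near_nb_ball (L : local_metrics R M) m (e : R) :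
  locally_metrizable L -> 0 < e -> \forall m' \near m, nb_ball L m e m'.
Proof.
move=> hL e0; have nbm : nbhs m (nb L m).
  by apply: open_nbhs_nbhs; split; [exact: lm_open|exact: lm_center].
have : within (nb L m) (nbhs m) (nb_ball L m e).
  apply/(lm_topology hL (lm_center hL m)); exists e => // y ny dy; split=> //.
  by rewrite (lm_sym hL ny (lm_center hL m)).
move=> H; have {}H : nbhs m [set m' | nb L m m' -> nb_ball L m e m'] := H.
have : nbhs m (nb_ball L m e) by apply: filterS2 H nbm => y; apply.
by [].
Qed.

Lemma almost_isometric_near (L : local_metrics R M) (eps : R)
    (X : banach_bundle R M) : locally_metrizable L -> C1_topology_bundle X ->
  eps < 1 -> almost_isometric_charts L eps X -> bilipschitz_near X.
Proof.
move=> hL hX eps1 [rad [eta H]] m; have [rad0 dE lip etaE] := H m.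
have [V V0 Veta] := limf_esup_near etaE eps1.
have [d /= d0 dV] := V0.
have B1 := near_nb_ball m hL rad0; have B2 := near_nb_ball m hL d0.
near=> m'.
have [nm _] : nb_ball L m (rad m) m' by near: m'.
have [_ dd] : nb_ball L m d m' by near: m'.
have im : bdom X m m' by rewrite dE; near: m'.
split=> //; have [mE|mm] := pselect (m' = m).
  have cV y : bchartV X m m y = y.
    by rewrite -[in RHS](c1_chartVK hX (c1_dom_center hX m) y) (c1_chart_id hX).
  rewrite mE; split=> x y; rewrite ?(c1_chart_id hX) ?cV.
    by rewrite ler_peMl // ler1n.
  by rewrite ler_peMl // ler1n.
have dist0 : 0 < dist L m m' m.
  rewrite lt_neqAle (lm_ge0 hL nm (lm_center hL m)) andbT eq_sym; apply/eqP.
  by move=> /(lm_eq0 hL nm (lm_center hL m)).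
have eta1 : eta m (dist L m m' m) <= 1.
  rewrite -lee_fin; apply: Veta; apply: dV => //=.
  by rewrite sub0r normrN gtr0_norm.
have le2 : 1 + eta m (dist L m m' m) <= 2 by lra.
have [/lipschitzP l1 /lipschitzP l2] := lip _ im.
by split=> x y; [rewrite (le_trans (l1 x y))|rewrite (le_trans (l2 x y))] => //;
  rewrite ler_wpM2r.
Unshelve. all: by end_near.
Qed.

Lemma almost_continuous_near (L : local_metrics R M) (eps eps' : R) (g : M -> R)
    m : locally_metrizable L -> eps < eps' -> almost_continuous L eps g ->
  \forall m' \near m, `|g m' - g m| <= eps'.
Proof.
move=> hL ee H; have [V [d /= d0 dV] Vg] := limf_esup_near (H m) ee.
have d20 : 0 < d / 2 by rewrite divr_gt0.
apply: filterS (near_nb_ball m hL d20) => m' mm'.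
rewrite -lee_fin (le_trans _ (Vg (d / 2) _)) //.
  by apply: ereal_sup_ubound; exists m'.
apply: dV => //=; rewrite sub0r normrN gtr0_norm // ltr_pdivrMr // ltr_pMr //.
by rewrite ltr1n.
Qed.

Section Chart.
Variables (X : banach_bundle R M) (hX : C1_topology_bundle X).

Lemma bchartV_id m y : bchartV X m m y = y.
Proof. by rewrite -[in RHS](c1_chartVK hX (c1_dom_center hX m) y) (c1_chart_id hX). Qed.

Lemma differentiable_bchart m0 m x : bdom X m0 m -> differentiable (bchart X m0 m) x.
Proof. by move=> /(c1_chart hX)[]. Qed.

(** The chart centered at [m] is the identity over [m], so the inverse of chart [m0] over [m] is the
    transition from chart [m] to chart [m0], which is differentiable by assumption. *)
Lemma differentiable_bchartV m0 m x : bdom X m0 m ->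
  differentiable (bchartV X m0 m) x.
Proof.
move=> im; have := c1_transition_diff hX (c1_dom_center hX m) im x.
have -> // : transition X m m0 m = bchartV X m0 m.
by apply/funext => y; rewrite /transition /= (c1_chart_id hX).
Qed.

Lemma diff_bchart_id m (x v : X m) : 'd (bchart X m m) x v = v.
Proof.
have -> : bchart X m m = id :> (X m -> X m).
  by apply/funext => y; exact: c1_chart_id.
by have -> : 'd id x = id :> (X m -> X m) by exact: diff_val.
Qed.

Lemma diff_bchartV_id m (x v : X m) : 'd (bchartV X m m) x v = v.
Proof.
have -> : bchartV X m m = id :> (X m -> X m).
  by apply/funext => y; exact: bchartV_id.
by have -> : 'd id x = id :> (X m -> X m) by exact: diff_val.
Qed.

Lemma diff_bchartVK m0 m (x v : X m) : bdom X m0 m ->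
  'd (bchart X m0 m) (bchartV X m0 m x) ('d (bchartV X m0 m) x v) = v.
Proof.
move=> im.
have := diff_comp (differentiable_bchartV x im) (differentiable_bchart (bchartV X m0 m x) im).
have -> : bchart X m0 m \o bchartV X m0 m = id.
  by apply/funext => y; exact: c1_chartVK.
have -> : 'd id x = id :> (X m -> X m) by exact: diff_val.
by move=> /(congr1 (fun g => g v)).
Qed.

Lemma diff_bchartK m0 m (x : X m0) (v : X m0) : bdom X m0 m ->
  'd (bchartV X m0 m) (bchart X m0 m x) ('d (bchart X m0 m) x v) = v.
Proof.
move=> im.
have := diff_comp (differentiable_bchart x im) (differentiable_bchartV (bchart X m0 m x) im).
have -> : bchartV X m0 m \o bchart X m0 m = id.
  by apply/funext => y; exact: c1_chartK.
have -> : 'd id x = id :> (X m0 -> X m0) by exact: diff_val.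
by move=> /(congr1 (fun g => g v)).
Qed.

End Chart.

Lemma near_pair_cst (T : topologicalType) (m : M) (x : T) (Q : M * T -> Prop) :
  (\forall q \near (m, x), Q q) -> \forall m' \near m, Q (m', x).
Proof.
move=> H; have c : {for m, continuous (fun m' : M => (m', x))}.
  by apply: cvg_pair; [exact: cvg_id|exact: cvg_cst].
exact: c _ H.
Qed.

Lemma near_comp (w : M -> M) (m : M) (Q : M -> Prop) : continuous w ->
  (\forall m' \near w m, Q m') -> \forall m' \near m, Q (w m').
Proof. by move=> cw H; exact: cw _ _ H. Qed.

Section Maps.
Variables (X Y Z : banach_bundle R M) (u w : M -> M).
Hypotheses (hX : C1_topology_bundle X) (hY : C1_topology_bundle Y)
  (hZ : C1_topology_bundle Z) (cu : continuous u) (cw : continuous w).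
Variables (H : forall m, X m * Y (u m) -> Z (w m)).
Hypothesis cH : continuous_bmap (A := bprod X Y u) (B := Z) (u := w) H.

Lemma near_center_bmap m (x : X m) (y : Y (u m)) (e : R) : 0 < e ->
  \forall q \near (m, (x, y)), bdom Z (w m) (w q.1) /\
    `|bchartV Z (w m) (w q.1)
        (@H q.1 (bchart X m q.1 q.2.1, bchart Y (u m) (u q.1) q.2.2)) -
      @H m (x, y)| <= e.
Proof.
move=> e0.
pose N := [set z : M * Z (w m) | `|z.2 - @H m (x, y)| <= e].
have NN : nbhs (w m, @H m (x, y)) N.
  have : \forall z \near @H m (x, y), `|z - @H m (x, y)| <= e.
    apply/nbhs_normP; exists e => // z; rewrite /= distrC; exact: ltW.
  move=> B; have := @cvg_snd _ _ (nbhs (w m)) (nbhs (@H m (x, y))) _ _ B; exact.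
have := @near_bmap R M (bprod X Y u) Z w H (m, u m) (w m) m (x, y) N.
apply => //.
- exact: dom_bprod_open.
- exact: c1_dom_open.
- exact: regular_chart_c1.
- by split; exact: c1_dom_center.
- exact: c1_dom_center.
- by rewrite /= !(c1_chart_id hX) !(c1_chart_id hY) (bchartV_id hZ).
Qed.

Lemma near_center_bmap_error m (x : X m) (y : Y (u m)) (e : R) :
  bilipschitz_near Z -> 0 < e -> \forall m' \near m,
    `|@H m' (bchart X m m' x, bchart Y (u m) (u m') y) -
      bchart Z (w m) (w m') (@H m (x, y))| <= e.
Proof.
move=> iZ e0; have e20 : 0 < e / 2 by rewrite divr_gt0.
have N1 := near_pair_cst (near_center_bmap x y e20).
have N2 : \forall m' \near m, bdom Z (w m) (w m') /\
    forall x y, `|bchart Z (w m) (w m') x - bchart Z (w m) (w m') y| <= 2 * `|x - y|.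
  by apply: filterS (near_comp cw (iZ (w m))) => m' [? []].
apply: filterS2 N1 N2 => m' /= [im A] [_ B].
rewrite -[X in `|X - _|](c1_chartVK hZ im).
by rewrite (le_trans (B _ _)) // mulrC -ler_pdivlMr.
Qed.

End Maps.

Lemma near_center_section (X Y : banach_bundle R M)
    (iX : forall m, X m) (iY : forall m, Y m) m (e : R) :
  C1_topology_bundle X -> C1_topology_bundle Y ->
  bilipschitz_near X -> bilipschitz_near Y ->
  continuous_section (B := bprod X Y id) (fun m => (iX m, iY m)) ->
  0 < e -> \forall m' \near m,
    `|iX m' - bchart X m m' (iX m)| <= e /\ `|iY m' - bchart Y m m' (iY m)| <= e.
Proof.
move=> hX hY lX lY cs e0; have e20 : 0 < e / 2 by rewrite divr_gt0.
pose N := [set z : M * (X m * Y m) | `|z.2 - (iX m, iY m)| <= e / 2].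
have NN : nbhs (m, (iX m, iY m)) N.
  have : \forall z \near (iX m, iY m), `|z - (iX m, iY m)| <= e / 2.
    apply/nbhs_normP; exists (e / 2) => // z; rewrite /= distrC; exact: ltW.
  move=> B; have := @cvg_snd _ _ (nbhs m) (nbhs (iX m, iY m)) _ _ B; exact.
have := @near_section R M (bprod X Y id) (fun m => (iX m, iY m)) (m, m) m N.
rewrite /= (bchartV_id hX) (bchartV_id hY).
have oB : forall k : M * M, open (bdom X k.1 `&` bdom Y k.2).
  by move=> k; apply: openI; exact: c1_dom_open.
move=> /(_ oB) Hn.
have rB : @regular_chart R M (bprod X Y id) (m, m).
  by apply: regular_chart_bprod => // ?; exact: cvg_id.
have := Hn rB cs (conj (c1_dom_center hX m) (c1_dom_center hY m)) NN.
move=> N1; apply: filterS3 N1 (lX m) (lY m) => m' [_ /= A] [im [B _]] [jm [D _]].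
have {}A : `|bchartV X m m' (iX m') - iX m| <= e / 2 /\
    `|bchartV Y m m' (iY m') - iY m| <= e / 2.
  by apply/andP; rewrite -ge_max -norm_pair.
case: A => A1 A2; split.
  rewrite -[X in `|X - _|](c1_chartVK hX im).
  by rewrite (le_trans (B _ _)) // mulrC -ler_pdivlMr.
rewrite -[X in `|X - _|](c1_chartVK hY jm).
by rewrite (le_trans (D _ _)) // mulrC -ler_pdivlMr.
Qed.

End CenterCharts.

(** * Continuity of the invariant map *)

Section InvariantNear.
Context {R : realType} {M : topologicalType} (X Y : banach_bundle R M) (u : M -> M).
Variables (F : forall m, X m * Y (u m) -> X (u m))
          (G : forall m, X m * Y (u m) -> Y m).
Context {q C : R} {Gam : M -> R -> Prop} {p th b ls lu : M -> R}.
Variable gd : gap_data F G q C Gam p th b ls lu.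
Variables (f : forall m, X m -> Y m) (xm : forall m, X m -> X (u m)).
Arguments f : clear implicits.
Arguments xm : clear implicits.
Hypotheses (f_lip : forall m x y, `|f m x - f m y| <= b m * `|x - y|).
Hypotheses (xm_lip : forall m x y, `|xm m x - xm m y| <= ls m * `|x - y|).
Hypotheses (fixF : forall m x, @F m (x, f (u m) (xm m x)) = xm m x).
Hypotheses (fixG : forall m x, @G m (x, f (u m) (xm m x)) = f m x).
Variables (iX : forall m, X m) (iY : forall m, Y m).
Hypotheses (f_i : forall m, f m (iX m) = iY m).
Hypotheses (xm_i : forall m, xm m (iX m) = iX (u m)).
Hypotheses (hX : C1_topology_bundle X) (hY : C1_topology_bundle Y).
Hypotheses (lX : bilipschitz_near X) (lY : bilipschitz_near Y).
Hypotheses (ci : continuous_section (B := bprod X Y id) (fun m => (iX m, iY m))).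
Hypotheses (cu : continuous u).
Hypotheses (cF : continuous_bmap (A := bprod X Y u) (B := X) (u := u) F).
Hypotheses (cG : continuous_bmap (A := bprod X Y u) (B := Y) (u := id) G).
Variable q2 : R.
Hypotheses (q2_01 : 0 <= q2 < 1).
Hypotheses (rate : forall m, \forall m' \near m, th m' * ls m * lu m' <= q2).

Record point_config := PointConfig {
  sp : total_space X; sm : M; sx : X sm }.

Let next_pt (j : total_space X) := Pt X (u (base j)) (xm (base j) (vec j)).
Let sg (t : point_config) :=
  @PointConfig (next_pt (sp t)) (u (sm t)) (xm (sm t) (sx t)).
Let chX (t : point_config) : X (sm t) := bchart X (base (sp t)) (sm t) (vec (sp t)).
Let rs (t : point_config) := @PointConfig (sp t) (sm t) (chX t).
Let E (j : total_space X) : set_system point_config := fun A =>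
  \forall m' \near base j, forall x', A (@PointConfig j m' x').
Let nx (t : point_config) : R := `|sx t - chX t|.
Let ny (t : point_config) : R := `|f (sm t) (sx t) -
  bchart Y (base (sp t)) (sm t) (f (base (sp t)) (vec (sp t)))|.
Let rho (t : point_config) : R := `|vec (sp t) - iX (base (sp t))|.
Let l (t : point_config) : R := ls (base (sp t)).

Let E_filter j : Filter (E j).
Proof.
split; first by rewrite /E; exact: nearW.
- move=> A B EA EB; apply: (@filterS2 _ (nbhs (base j)) _ _ _ _ _ EA EB) => m' Am Bm x'.
  by split; [exact: Am|exact: Bm].
- by move=> A B AB; apply: (@filterS _ (nbhs (base j))) => m' Am x'; exact/AB/Am.
Qed.

Let E_all i A : (forall m' x', A (@PointConfig i m' x')) -> E i A.
Proof. by move=> EA; rewrite /E; apply: nearW => m' x'. Qed.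

Let c := C / (1 - q).
Let c_ge0 : 0 <= c.
Proof.
by rewrite divr_ge0 ?(gd_C gd) // subr_ge0; case/andP: (gd_q gd) => _ /ltW.
Qed.

(** Transported to the fibers near [m] by center charts, the orbit of [(m, x)] satisfies the
    invariance equations up to errors that vanish by continuity of [F] and [G]; it is an approximate
    configuration, compared with the exact one of [x']. The size [rho] is multiplied by at most [ls]
    because [xm] preserves the section. *)
Lemma invariant_near (m : M) (x : X m) e : 0 < e ->
  exists2 d : R, 0 < d & \forall m' \near m, forall x',
    `|x' - bchart X m m' x| <= d ->
    `|f m' x' - bchart Y m m' (f m x)| <= e /\
    `|xm m' x' - bchart X (u m) (u m') (xm m x)| <= e.
Proof.
move=> e0.
have /andP[q0 q1] := gd_q gd; have C0 := gd_C gd.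
have q1' : 0 < 1 - q by rewrite subr_gt0.
have h1 t : sm (sg t) = u (sm t) by [].
have h2 t : sm (rs t) = sm t by [].
have h3 i A : E (next_pt i) A -> E i (sg @^-1` A).
  move=> /cu H; have {}H : \forall m' \near base i, forall x',
      A (@PointConfig (next_pt i) (u m') x') by exact: H.
  by apply: (@filterS _ (nbhs (base i)) _ _ _ _ H) => m' Am x'; exact: Am.
have h4 i A : E i A -> E i (rs @^-1` A).
  by apply: (@filterS _ (nbhs (base i))) => m' Am x'; exact: Am.
have h5 t : nx (rs t) <= 0 by rewrite /nx /rs /= /chX subrr normr0.
have h6 t : rho (rs t) <= rho t by [].
have h7 i : \forall t \near E i, ny t <= ny (rs t) + b (sm t) * nx t.
  apply: E_all => m' x'; rewrite /ny /nx /= [leRHS]addrC.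
  set y := chX _; rewrite (le_trans (ler_distD (f m' y) _ _)) // lerD2r.
  exact: f_lip.
have k0 : 0 <= 4 * C / (1 - q) by rewrite divr_ge0 ?mulr_ge0 // ltW.
have h10 t : 0 <= l t <= C by exact: gd_ls gd _.
have h10' t : 0 <= rho t by exact: normr_ge0.
have h11 i : \forall t \near E i, rho (sg t) <= l t * rho t.
  by apply: E_all => m' x'; rewrite /rho /= -xm_i; exact: xm_lip.
have h12 i : \forall t \near E i, th (sm t) * l t * lu (sm t) <= q2.
  by apply: (@filterS _ (nbhs (base i)) _ _ _ _ (rate (base i))) => m' H x'.
have h13 : @chain_bound _ _ Gam _ _ E sm nx ny rho (4 * C / (1 - q)).
  move=> [m1 x1] r e' r0 e'0; have C1 : 0 < 2 * C + 1 by rewrite ltr_wpDl // mulr_ge0.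
  pose d := e' * (1 - q) / (2 * C + 1).
  have d0 : 0 < d by rewrite divr_gt0 // mulr_gt0.
  have dE : d * (2 * C + 1) = e' * (1 - q) by rewrite divfK // gt_eqF.
  exists d => //; rewrite /E /=.
  have N1 := near_center_section m1 hX hY lX lY ci d0.
  apply: (@filterS3 _ (nbhs m1) _ _ _ _ _ _ N1 (lX m1) (lY m1)).
  move=> m' [iXd iYd] [im [BX _]] [_ [BY _]] x' a.
  move=> /(gd_Gam gd)[/andP[a0 aC] abq] rt nxt.
  have bb := gd_b gd m'; have /andP[b0 bC] := bb.
  have /andP[b1 b1C] := gd_b gd m1.
  set tt := PointConfig _ _ in rt nxt *.
  (* The comparison passes through [iY]: on the section the values of [f] over [m1] and [m'] are
     close by continuity of [i], and the rest is Lipschitz in the distance to the section. *)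
  have nyK : ny tt <= b m' * nx tt + (4 * C * rho tt + (C + 1) * d).
    rewrite /ny /nx /rho /chX /=; set y := bchart X m1 m' x1.
    have T1 := ler_distD (f m' y) (f m' x') (bchart Y m1 m' (f m1 x1)).
    have T2 := ler_distD (iY m') (f m' y) (bchart Y m1 m' (f m1 x1)).
    have T3 := ler_distD (bchart Y m1 m' (iY m1)) (iY m') (bchart Y m1 m' (f m1 x1)).
    have T4 := BY (iY m1) (f m1 x1); have T5 := f_lip (iX m1) x1.
    rewrite f_i [`|iX m1 - x1|]distrC in T5.
    have T6 := f_lip y (iX m'); rewrite f_i in T6.
    have T7 := ler_distD (bchart X m1 m' (iX m1)) y (iX m').
    have T8 := BX x1 (iX m1); rewrite [`|bchart X m1 m' (iX m1) - _|]distrC in T7.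
    have T9 := f_lip x' y.
    have U1 : b m1 * `|x1 - iX m1| <= C * `|x1 - iX m1| by rewrite ler_wpM2r.
    have U2 : b m' * `|y - iX m'| <= C * (2 * `|x1 - iX m1| + d).
      by rewrite ler_pM // (le_trans T7) // lerD.
    by move: T1 T2 T3 T4 T5 T6 T9 U1 U2 iYd; lra.
  have := apriori_bound gd bb abq (normr_ge0 _) (ltW d0) nyK nxt.
  move=> /le_trans; apply; rewrite ler_pdivrMr //.
  have -> : (4 * C / (1 - q) * rho tt + e') * (1 - q) =
      4 * C * rho tt + d * (2 * C + 1).
    by rewrite dE; field; rewrite gt_eqF.
  by lra.
have h14 i r e' : 0 <= r -> 0 < e' -> exists2 d : R, 0 < d &
    \forall t \near E i, forall a, Gam (sm t) a ->
    rho t <= r -> nx t <= a * ny t + d ->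
    nx (sg t) <= p (sm t) * ny (sg t) + e' /\
    ny t <= lu (sm t) * ny (sg t) + e'.
  move=> r0 e'0; pose e1 := e' / (c * (1 + C) + 1).
  have e10 : 0 < e1 by rewrite divr_gt0 // ltr_wpDl // mulr_ge0 // addr_ge0.
  exists e1 => //; case: i => m1 x1; rewrite /E /=.
  pose y1 := f (u m1) (xm m1 x1).
  have N1 := near_center_bmap_error hX hY hX cu cu cF x1 y1 lX e10.
  have ci' : continuous (id : M -> M) by move=> ?; exact: cvg_id.
  have N2 := near_center_bmap_error hX hY hY cu ci' cG x1 y1 lY e10.
  apply: (@filterS2 _ (nbhs m1) _ _ _ _ _ N1 N2).
  move=> m' E1 E2 x' a Ga rt nxt.
  have [/= aC _] := gd_Gam gd Ga; have /andP[a0 _] := aC.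
  rewrite /= fixF in E1; rewrite /= fixG in E2.
  have := robust_cone_approx (gd_cone gd Ga) a0 c_ge0 (ltW e10) E1 E2.
  move=> /(_ x' (f (u m') (xm m' x'))); rewrite fixF fixG => /(_ nxt) [S1 S2].
  have ee := step_error gd c_ge0 aC e'0.
  by split; [rewrite (le_trans S1)|rewrite (le_trans S2)] => //; rewrite lerD2l.
pose j := Pt X m x.
have [d d0 H1] := @gap_chain _ _ _ _ _ _ _ _ _ _ _ _ _ _ _ gd _ _ _ E sg rs
    sm nx ny rho l _ _ E_filter
    h1 h2 h3 h4 h5 h6 h7 q2_01 k0 h10 h10' h11 h12 h13 h14 j (rho (PointConfig j x)) e (normr_ge0 _) e0.
have [d' d'0 H2] := @gap_chain_next _ _ _ _ _ _ _ _ _ _ _ _ _ _ _ gd _ _ _ E sg rs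
    sm nx ny rho l _ _ E_filter
    h1 h2 h3 h4 h5 h6 h7 q2_01 k0 h10 h10' h11 h12 h13 h14 j (rho (PointConfig j x)) e (normr_ge0 _) e0.
exists (Num.min d d'); first by rewrite lt_min d0.
apply: (@filterS2 _ (nbhs m) _ _ _ _ _ H1 H2) => m' A B x'.
by rewrite le_min => /andP[xd xd']; split; [exact: A|exact: B].
Qed.

End InvariantNear.

(** * Continuity of the differential *)

Section VerticalMaps.
Context {R : realType} {M : topologicalType}.

Lemma diff_prod_map (V1 V2 W1 W2 : normedModType R) (g : V1 -> W1)
    (h : V2 -> W2) z v : differentiable g z.1 -> differentiable h z.2 ->
  'd (fun z : V1 * V2 => (g z.1, h z.2)) z v =
    ('d g (z.1) v.1, 'd h (z.2) v.2).
Proof.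
move=> dg dh.
have cf : continuous (fst : V1 * V2 -> V1) by move=> t; exact: cvg_fst.
have cs : continuous (snd : V1 * V2 -> V2) by move=> t; exact: cvg_snd.
have df : differentiable (fst : V1 * V2 -> V1) z by exact: linear_differentiable.
have ds : differentiable (snd : V1 * V2 -> V2) z by exact: linear_differentiable.
have d1 : differentiable (g \o fst) z by apply: differentiable_comp.
have d2 : differentiable (h \o snd) z by apply: differentiable_comp.
have -> : (fun z : V1 * V2 => (g z.1, h z.2)) =
  (fun z => ((g \o fst) z, (h \o snd) z)) by [].
rewrite diff_pair // (diff_comp df dg) (diff_comp ds dh) /=.
have -> : 'd fst z = fst :> (V1 * V2 -> V1) by exact: diff_lin.
by have -> : 'd snd z = snd :> (V1 * V2 -> V2) by exact: diff_lin.
Qed.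

Section Maps.
Variables (X Y Z : banach_bundle R M) (u w : M -> M).
Hypotheses (hX : C1_topology_bundle X) (hY : C1_topology_bundle Y)
  (hZ : C1_topology_bundle Z) (cu : continuous u) (cw : continuous w).
Variables (H : forall m, X m * Y (u m) -> Z (w m)).
Hypothesis vH : continuous_vmap (A := bprod X Y u) (B := Z) (u := w) H
  (Dv (A := bprod X Y u) (B := Z) (u := w) H).

Lemma near_center_vmap m (x : X m) (y : Y (u m)) (e : R) : 0 < e ->
  \forall q \near (m, (x, y)),
    [/\ bdom X m q.1, bdom Y (u m) (u q.1), bdom Z (w m) (w q.1) &
    forall v v',
      let z := (bchart X m q.1 q.2.1, bchart Y (u m) (u q.1) q.2.2) in
      `|'d (bchartV Z (w m) (w q.1)) (@H q.1 z)
          ('d (@H q.1) z ('d (bchart X m q.1) (q.2.1) v,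
                          'd (bchart Y (u m) (u q.1)) (q.2.2) v')) -
        'd (@H m) (x, y) (v, v')| <= e * (`|v| + `|v'|)].
Proof.
move=> e0.
pose D := [set p : M * model (bprod X Y u) (m, u m) |
  dom (bprod X Y u) (m, u m) p.1 /\ dom Z (w m) (w p.1)].
have Dm : D (m, (x, y)) by split; [split|]; exact: c1_dom_center.
have near1 : nbhs (m, (x, y)) [set q | bdom X m q.1].
  exact: near_dom (c1_dom_open hX m) (c1_dom_center hX m).
have open_pre (V : banach_bundle R M) (g : M -> M) : C1_topology_bundle V ->
    continuous g -> open (g @^-1` bdom V (g m)).
  by move=> hV cg; apply: open_comp; [move=> ? _; exact: cg|exact: c1_dom_open].
have near2 : nbhs (m, (x, y)) [set q | bdom Y (u m) (u q.1)].
  exact: near_dom (open_pre Y u hY cu) (c1_dom_center hY _).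
have near3 : nbhs (m, (x, y)) [set q | bdom Z (w m) (w q.1)].
  exact: near_dom (open_pre Z w hZ cw) (c1_dom_center hZ _).
pose rep (q : M * (X m * Y (u m))) (v : X m * Y (u m)) : Z (w m) :=
  let z := chart (bprod X Y u) (m, u m) q.1 q.2 in
  'd (bchartV Z (w m) (w q.1)) (@H q.1 z) ('d (@H q.1) z
    ('d (chart (bprod X Y u) (m, u m) q.1) (q.2) v)).
have N0 : nbhs (m, (x, y))
    [set q | D q -> (opnorm (rep q \- rep (m, (x, y)))%R <= e%:E)%E].
  exact: vH Dm _ e0.
have : nbhs (m, (x, y)) [set q | [/\ bdom X m q.1, bdom Y (u m) (u q.1),
    bdom Z (w m) (w q.1) & (opnorm (rep q \- rep (m, (x, y)))%R <= e%:E)%E]].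
  apply: filterS2 N0 (filterI near1 (filterI near2 near3)).
  move=> q Nq [q1 [q2 q3]]; have Dq : D q by split; [split|].
  by split=> //; exact: Nq.
apply: filterS => -[m' [x' y']] [q1 q2 q3 /opnorm_leP A]; split=> // v v'; cbv zeta.
have dXm' := differentiable_bchart hX x' q1.
have dYm' := differentiable_bchart hY y' q2.
have dXm := differentiable_bchart hX x (c1_dom_center hX m).
have dYm := differentiable_bchart hY y (c1_dom_center hY (u m)).
have repZ q k v0 : rep q (k *: v0) = k *: rep q v0.
  by rewrite /rep /= !linearZ.
have AZ k v0 : 0 < k -> (rep (m', (x', y')) \- rep (m, (x, y))) (k *: v0) =
    k *: (rep (m', (x', y')) \- rep (m, (x, y))) v0.
  by move=> _; rewrite -[LHS]/(rep _ _ - rep _ _) !repZ -scalerBr.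
have A0 : (rep (m', (x', y')) \- rep (m, (x, y))) 0 = 0.
  rewrite -[LHS]/(rep _ _ - rep _ _).
  have rep0 q : rep q 0 = 0 by have := repZ q 0 0; rewrite !scale0r.
  by rewrite !rep0 subr0.
have := le_norm_scale AZ A0 A (v, v').
rewrite /rep /= (@diff_prod_map _ _ _ _ (bchart X m m') (bchart Y (u m) (u m')) (x', y')) //.
rewrite (@diff_prod_map _ _ _ _ (bchart X m m) (bchart Y (u m) (u m)) (x, y)) //=.
rewrite (diff_bchart_id hX) (diff_bchart_id hY) (diff_bchartV_id hZ).
rewrite (c1_chart_id hX) (c1_chart_id hY) => /le_trans; apply.
by rewrite ler_wpM2l ?(ltW e0) // norm_pair_le.
Qed.

End Maps.
End VerticalMaps.

Section CenterContinuity.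
Context {R : realType} {M : topologicalType} (X Y : banach_bundle R M) (u : M -> M).
Variables (F : forall m, X m * Y (u m) -> X (u m))
          (G : forall m, X m * Y (u m) -> Y m).
Context {q C : R} {Gam : M -> R -> Prop} {p th b ls lu : M -> R}.
Variable gd : gap_data F G q C Gam p th b ls lu.
Variables (f : forall m, X m -> Y m) (xm : forall m, X m -> X (u m)).
Arguments f : clear implicits.
Arguments xm : clear implicits.
Hypotheses (f_lip : forall m x y, `|f m x - f m y| <= b m * `|x - y|).
Hypotheses (xm_lip : forall m x y, `|xm m x - xm m y| <= ls m * `|x - y|).
Hypotheses (fixF : forall m x, @F m (x, f (u m) (xm m x)) = xm m x).
Hypotheses (fixG : forall m x, @G m (x, f (u m) (xm m x)) = f m x).
Variables (iX : forall m, X m) (iY : forall m, Y m).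
Hypotheses (f_i : forall m, f m (iX m) = iY m).
Hypotheses (xm_i : forall m, xm m (iX m) = iX (u m)).
Hypotheses (hX : C1_topology_bundle X) (hY : C1_topology_bundle Y).
Hypotheses (lX : bilipschitz_near X) (lY : bilipschitz_near Y).
Hypotheses (ci : continuous_section (B := bprod X Y id) (fun m => (iX m, iY m))).
Hypotheses (cu : continuous u).
Hypotheses (cF : continuous_bmap (A := bprod X Y u) (B := X) (u := u) F).
Hypotheses (cG : continuous_bmap (A := bprod X Y u) (B := Y) (u := id) G).
Hypotheses (dF : forall m z, differentiable (@F m) z).
Hypotheses (dG : forall m z, differentiable (@G m) z).
Hypotheses (vF : continuous_vmap (A := bprod X Y u) (B := X) (u := u) F
  (Dv (A := bprod X Y u) (B := X) (u := u) F)).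
Hypotheses (vG : continuous_vmap (A := bprod X Y u) (B := Y) (u := id) G
  (Dv (A := bprod X Y u) (B := Y) (u := id) G)).
Variable q2 : R.
Hypotheses (q2_01 : 0 <= q2 < 1).
Hypotheses (rate : forall m, \forall m' \near m, th m' * ls m * lu m' <= q2).

Let near_inv := invariant_near gd f_lip xm_lip fixF fixG f_i xm_i hX hY lX lY ci
  cu cF cG q2_01 rate.

(** The first point is fixed. The second one is close to its transport by the center chart, with one
    threshold [d] for all base points near [base j]. *)
Let P (j : total_space X) : set_system (pair_config X) := fun A =>
  exists2 d : R, 0 < d & \forall m' \near base j, forall x' : X m',
    `|x' - bchart X (base j) m' (vec j)| <= d -> A (PairConfig (vec j) x').

Let P_filter j : Filter (P j).
Proof.
split; first by exists 1 => //; exact: nearW.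
- move=> A B [d d0 Ad] [d' d'0 Bd]; exists (Num.min d d').
    by rewrite lt_min d0.
  apply: filterS2 Ad Bd => m' Ad Bd x'; rewrite le_min => /andP[xd xd'].
  by split; [exact: Ad|exact: Bd].
- move=> A B AB [d d0 Ad]; exists d => //.
  by apply: filterS Ad => m' Ad x' xd; exact/AB/Ad.
Qed.

(** Stability of the filter under one step is the continuity of [xm] in center charts. *)
Let P_next j A : P (Pt X (u (base j)) (xm (base j) (vec j))) A ->
  P j ((next_pair xm) @^-1` A).
Proof.
case=> d d0 H; case: j H => m x /= H.
have [d' d'0 N] := near_inv x d0; exists d' => //=.
have {}H := near_comp cu H.
by apply: filterS2 H N => m' H N x' /N[_ xd]; exact: H.
Qed.

Let near_config (j : total_space X) (A : set (M * (X (base j) * Y (u (base j))))) :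
  nbhs (base j, graph_pt f xm (vec j)) A -> \forall c \near P j,
    A (pm' c, (bchartV X (base j) (pm' c) (px' c),
      bchartV Y (u (base j)) (u (pm' c)) (f (u (pm' c)) (xm (pm' c) (px' c))))).
Proof.
case: j A => m x /= A NA.
have [[U V] /= [Um Vx] UVA] := NA.
have /nbhs_normP[e /= e0 Ve] := Vx.
have e40 : 0 < e / 4 by rewrite divr_gt0.
(* The second component of a graph point is [f] after [xm], so [near_inv] is used twice, first at
   the image point. The quarter of [e] absorbs the factor 2 of the inverse charts and leaves a
   strict inequality. *)
have [d1 d10 N1] := near_inv (xm m x) e40.
have [d2 d20 N2] := near_inv x d10.
exists (Num.min d2 (e / 4)); first by rewrite lt_min d20.
have {}N1 := near_comp cu N1; have lY' := near_comp cu (lY (u m)).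
have NU : \forall m' \near m, U m' by exact: Um.
near=> m' => x'; rewrite le_min => /andP[xd xe].
have [im [_ lV]] : bdom X m m' /\
    (forall x y, `|bchart X m m' x - bchart X m m' y| <= 2 * `|x - y|) /\
    (forall x y, `|bchartV X m m' x - bchartV X m m' y| <= 2 * `|x - y|).
  by near: m'; exact: lX.
have [jm [_ lW]] : bdom Y (u m) (u m') /\
    (forall x y, `|bchart Y (u m) (u m') x - bchart Y (u m) (u m') y| <= 2 * `|x - y|) /\
    (forall x y, `|bchartV Y (u m) (u m') x - bchartV Y (u m) (u m') y| <= 2 * `|x - y|).
  by near: m'; exact: lY'.
have [_ x2d] : `|f m' x' - bchart Y m m' (f m x)| <= d1 /\
    `|xm m' x' - bchart X (u m) (u m') (xm m x)| <= d1.
  by move: x' xd {xe}; near: m'; exact: N2.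
have [y2d _] : `|f (u m') (xm m' x') - bchart Y (u m) (u m') (f (u m) (xm m x))| <= e / 4 /\
    `|xm (u m') (xm m' x') - bchart X (u (u m)) (u (u m')) (xm (u m) (xm m x))| <= e / 4.
  by move: (xm m' x') x2d; near: m'; exact: N1.
apply: UVA; split=> /=; first by near: m'.
apply: Ve; rewrite /= distrC.
rewrite -[X in `|X|]/(bchartV X m m' x' - x,
  bchartV Y (u m) (u m') (f (u m') (xm m' x')) - f (u m) (xm m x)).
rewrite norm_pair gt_max; apply/andP; split.
  rewrite -[X in _ - X](c1_chartK hX im x) (le_lt_trans (lV _ _)) //.
  by move: xe e0; lra.
rewrite -[X in _ - X](c1_chartK hY jm (f (u m) (xm m x))) (le_lt_trans (lW _ _)) //.
by move: y2d e0; lra.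
Unshelve. all: by end_near.
Qed.

(** The chart is differentiated at the coordinates of the perturbed point: this is the
    identification that occurs in the local representatives of [Dv F] and [Dv G]. *)
Let Phi (c : pair_config X) : X (pm c) -> X (pm' c) :=
  'd (bchart X (pm c) (pm' c)) (bchartV X (pm c) (pm' c) (px' c)).
Let Psi (c : pair_config X) : Y (pm c) -> Y (pm' c) :=
  'd (bchart Y (pm c) (pm' c)) (bchartV Y (pm c) (pm' c) (f (pm' c) (px' c))).

Let bound_diff (Z : banach_bundle R M) m m' (x v : Z m) :
  C1_topology_bundle Z -> bdom Z m m' ->
  (forall x y, `|bchart Z m m' x - bchart Z m m' y| <= 2 * `|x - y|) ->
  `|'d (bchart Z m m') x v| <= 2 * `|v|.
Proof.
move=> hZ im lZ; apply: diff_lipschitz; last exact: differentiable_bchart.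
by move=> [y z] _; exact: lZ.
Qed.

Let bound j : \forall c \near P j,
  (forall v, `|Phi (c := c) v| <= 2 * `|v|) /\
  (forall v, `|Psi (c := c) v| <= 2 * `|v|).
Proof.
case: j => m x; exists 1 => //=.
apply: filterS2 (lX m) (lY m) => m' [im [A _]] [jm [B _]] x' _.
by split=> v; apply: bound_diff.
Qed.

Let rateP j : \forall c \near P j, th (pm' c) * ls (pm c) * lu (pm' c) <= q2.
Proof.
case: j => m x; exists 1 => //=.
by apply: filterS (rate m) => m' H x' _.
Qed.

Let transport (Z : banach_bundle R M) m m' (y A : Z m') (B : Z m) (e : R) :
  C1_topology_bundle Z -> bdom Z m m' ->
  (forall x y, `|bchart Z m m' x - bchart Z m m' y| <= 2 * `|x - y|) ->
  `|'d (bchartV Z m m') y A - B| <= e ->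
  `|A - 'd (bchart Z m m') (bchartV Z m m' y) B| <= 2 * e.
Proof.
move=> hZ im lZ Ae; rewrite -[X in `|X - _|](diff_bchartVK hZ y A im) -linearB.
by rewrite (le_trans (bound_diff _ _ hZ im lZ)) // ler_wpM2l.
Qed.

Let error j e : 0 < e -> \forall c \near P j, forall v w,
  `|'d (@F (pm' c)) (graph_pt f xm (px' c)) (Phi (c := c) v, Psi (c := next_pair xm c) w) -
    Phi (c := next_pair xm c) ('d (@F (pm c)) (graph_pt f xm (px c)) (v, w))|
    <= e * (`|v| + `|w|) /\
  `|'d (@G (pm' c)) (graph_pt f xm (px' c)) (Phi (c := c) v, Psi (c := next_pair xm c) w) -
    Psi (c := c) ('d (@G (pm c)) (graph_pt f xm (px c)) (v, w))|
    <= e * (`|v| + `|w|).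
Proof.
move=> e0; have e20 : 0 < e / 2 by rewrite divr_gt0.
case: j => m x; pose y := f (u m) (xm m x).
have ci' : continuous (id : M -> M) by move=> ?; exact: cvg_id.
(* The estimate of [near_center_vmap], valid near the reference graph point, is evaluated at the
   graph point of the perturbed configuration. It is stated in the center fiber, and [transport]
   carries it to the fiber over [m'], doubling [e / 2]. *)
have NF := @near_config (Pt X m x) _ (near_center_vmap hX hY hX cu cu vF x y e20).
have NG := @near_config (Pt X m x) _ (near_center_vmap hX hY hY cu ci' vG x y e20).
have [d1 d10 N1] := NF; have [d2 d20 N2] := NG.
exists (Num.min d1 d2) => /=; first by rewrite lt_min d10.
apply: filterS3 (filterI N1 N2) (near_comp cu (lX (u m))) (lY m).
move=> m' [{}N1 {}N2] [i1 [l1 _]] [i2 [l2 _]] x'.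
rewrite le_min => /andP[/N1[/= im jm _ EF] /N2[/= _ _ _ EG]] v w.
have hw := EF v w; have hw' := EG v w.
move: hw hw'; rewrite /= (c1_chartVK hX im) (c1_chartVK hY jm) fixF fixG => hw hw'.
have E2 : forall z : R, 2 * (e / 2 * z) = e * z by move=> z; field.
split.
  rewrite -E2; exact: transport hX i1 l1 hw.
rewrite -E2; exact: transport hY i2 l2 hw'.
Qed.

Lemma center_continuity (m : M) (x : X m) e : 0 < e ->
  exists2 d : R, 0 < d & \forall m' \near m, forall x' : X m',
    `|x' - bchart X m m' x| <= d -> forall v, `|v| <= 1 ->
    `|'d (f m') x' ('d (bchart X m m') (bchartV X m m' x') v) -
      'd (bchart Y m m') (bchartV Y m m' (f m' x')) ('d (f m) x v)| <= e.
Proof.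
move=> e0.
have := differential_comparison gd f_lip xm_lip fixF fixG dF dG q2_01 P_filter
  P_next rateP bound error (Pt X m x) e0.
exact.
Qed.

End CenterContinuity.

Lemma opnorm_sub_le (R : realType) (V W : normedModType R) (A A' : {linear V -> W})
    (e : R) : (opnorm (A \- A')%R <= e%:E)%E ->
  forall v, `|A v - A' v| <= e * `|v|.
Proof.
move=> /opnorm_leP; apply: (@le_norm_scale R V W (A \- A')).
- by move=> k v _; rewrite -[LHS]/(A (k *: v) - A' (k *: v)) !linearZ /=; lmod R.
- by rewrite -[LHS]/(A 0 - A' 0) !linear0 addr0.
Qed.

(** * From center charts to arbitrary charts *)

Section VerticalContinuity.
Context {R : realType} {M : topologicalType} (X Y : banach_bundle R M).
Hypotheses (hX : C1_topology_bundle X) (hY : C1_topology_bundle Y).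
Hypotheses (lX : bilipschitz_near X) (lY : bilipschitz_near Y).

Let diff_chart_transition (Z : banach_bundle R M) i m m' (z v : Z i) :
  C1_topology_bundle Z -> bdom Z i m' -> bdom Z m m' ->
  'd (bchart Z i m') z v = 'd (bchart Z m m') (bchartV Z m m' (bchart Z i m' z))
    ('d (transition Z i m m') z v).
Proof.
move=> hZ im mm.
have E : bchart Z m m' \o transition Z i m m' = bchart Z i m'.
  by apply/funext => w; rewrite /transition /= (c1_chartVK hZ mm).
have := diff_comp (c1_transition_diff hZ im mm z)
  (differentiable_bchart hZ (transition Z i m m' z) mm).
by rewrite E => ->.
Qed.

Let diff_chartV_transition (Z : banach_bundle R M) j m m' (z v : Z m') :
  C1_topology_bundle Z -> bdom Z j m' -> bdom Z m m' ->
  'd (bchartV Z j m') z v = 'd (transition Z m j m') (bchartV Z m m' z)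
    ('d (bchartV Z m m') z v).
Proof.
move=> hZ jm mm.
have E : transition Z m j m' \o bchartV Z m m' = bchartV Z j m'.
  by apply/funext => w; rewrite /transition /= (c1_chartVK hZ mm).
have := diff_comp (differentiable_bchartV hZ z mm)
  (c1_transition_diff hZ mm jm (bchartV Z m m' z)).
by rewrite E => ->.
Qed.

Let diff_bound (V W : normedModType R) (g : V -> W) z : differentiable g z ->
  exists2 K : R, 0 <= K & forall v, `|'d g z v| <= K * `|v|.
Proof.
move=> /diff_continuous /linear_bounded_continuous /bounded_funP /(_ 1)[K HK].
exists K; first by have := HK 0; rewrite linear0 !normr0 ler01; exact.
by apply: le_norm_scale => [k v _||//]; rewrite ?linearZ ?linear0.
Qed.

Variables (f : forall m, X m -> Y m) (C : R).
Arguments f : clear implicits.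
Hypothesis C_ge0 : 0 <= C.
Hypotheses (df_le : forall m x v, `|'d (f m) x v| <= C * `|v|).
Hypotheses (f_near : forall m (x : X m) (e : R), 0 < e ->
  exists2 d : R, 0 < d & \forall m' \near m, forall x',
    `|x' - bchart X m m' x| <= d -> `|f m' x' - bchart Y m m' (f m x)| <= e).
Hypotheses (df_near : forall m (x : X m) (e : R), 0 < e ->
  exists2 d : R, 0 < d & \forall m' \near m, forall x' : X m',
    `|x' - bchart X m m' x| <= d -> forall v, `|v| <= 1 ->
    `|'d (f m') x' ('d (bchart X m m') (bchartV X m m' x') v) -
      'd (bchart Y m m') (bchartV Y m m' (f m' x')) ('d (f m) x v)| <= e).

(** Over [m'] near [m], the representative in charts [i] and [j] is the transition differential
    [tau] from [i] to [m], then the representative in the charts centered at [m], then the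
    transition differential [tht] from [m] to [j]. Each factor varies little in operator norm. *)
Lemma continuous_vmap_center :
  continuous_vmap (A := X) (B := Y) (u := id) f (K1 f).
Proof.
move=> i j [m z0] [/= im jm] e e0.
set x := bchart X i m z0; set y := f m x.
have mX := c1_dom_center hX m; have mY := c1_dom_center hY m.
pose tau (q : M * X i) : X i -> X m := 'd (transition X i m q.1) (q.2).
pose tht (r : M * Y m) : Y m -> Y j := 'd (transition Y m j r.1) (r.2).
have [K2 K20 tau0] : exists2 K : R, 0 <= K & forall v, `|tau (m, z0) v| <= K * `|v|.
  exact/diff_bound/c1_transition_diff.
have [K1 K10 tht0] : exists2 K : R, 0 <= K & forall v, `|tht (m, y) v| <= K * `|v|.
  exact/diff_bound/c1_transition_diff.
pose A := K2 + 1; have A0 : 0 <= A by rewrite addr_ge0.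
(* The local [K1] bounds [tht (m, y)]. The first term pays for the variation of [tht], the second
   for the estimate in center charts, the third for the variation of [tau]; [e1 <= 1] makes the
   quadratic error linear. *)
pose K := (C + 2) * A + 2 * K1 * A + K1 * C + 1.
have K0 : 0 < K.
  by rewrite ltr_wpDl // !addr_ge0 // !mulr_ge0 // addr_ge0.
pose e1 := Num.min 1 (e / K).
have e10 : 0 < e1 by rewrite lt_min ltr01 divr_gt0.
have e11 : e1 <= 1 by rewrite ge_min lexx.
have e1K : e1 * K <= e by rewrite -ler_pdivlMr // ge_min lexx orbT.
have Ntau : nbhs (m, z0) [set q | ((bdom X i `&` bdom X m) `*` [set: X i]) q ->
    (opnorm (tau q \- tau (m, z0))%R <= e1%:E)%E].
  have D0 : ((bdom X i `&` bdom X m) `*` [set: X i]) (m, z0) by [].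
  exact: (c1_transition_C1 hX D0 e10).
have Ntht : nbhs (m, y) [set r | ((bdom Y m `&` bdom Y j) `*` [set: Y m]) r ->
    (opnorm (tht r \- tht (m, y))%R <= e1%:E)%E].
  have D0 : ((bdom Y m `&` bdom Y j) `*` [set: Y m]) (m, y) by [].
  exact: (c1_transition_C1 hY D0 e10).
have [[U V] /= [Um Vy] UV] := Ntht.
have /nbhs_normP[e3 /= e30 Ve] := Vy.
have e34 : 0 < e3 / 4 by rewrite divr_gt0.
have [d1 d10 N1] := f_near x e34.
have [d2 d20 N2] := df_near x e10.
pose d := Num.min d1 d2 / 2.
have d0 : 0 < d by rewrite divr_gt0 // lt_min d10.
have Nx : nbhs (m, z0) [set q | `|bchartV X m q.1 (bchart X i q.1 q.2) - x| < d].
  have [_ reg] := regular_chart_c1 m hX.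
  have cx := reg i m z0 im mX.
  have /= := cx [set w | `|w - x| < d]; apply.
  rewrite /= (bchartV_id hX); apply/nbhs_normP; exists d => // w.
  by rewrite /= distrC.
have ND : nbhs (m, z0) [set q | bdom X i q.1 /\ bdom Y j q.1].
  apply: filterI; first exact: near_dom (c1_dom_open hX i) im.
  exact: near_dom (c1_dom_open hY j) jm.
pose base_ok m' := [/\ bdom X m m', bdom Y m m', U m',
  (forall x y, `|bchart X m m' x - bchart X m m' y| <= 2 * `|x - y|) &
  (forall x y, `|bchartV Y m m' x - bchartV Y m m' y| <= 2 * `|x - y|)].
have NB : nbhs m [set m' | base_ok m'].
  have NU : nbhs m [set m' | U m'] := Um.
  apply: filterS3 NU (lX m) (lY m) => m' Um' [i1 [l1 _]] [i2 [_ l2]].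
  by split.
have NB' : nbhs (m, z0) [set q | [/\ base_ok q.1,
    (forall x' : X q.1, `|x' - bchart X m q.1 x| <= d1 ->
      `|f q.1 x' - bchart Y m q.1 (f m x)| <= e3 / 4) &
    (forall x' : X q.1, `|x' - bchart X m q.1 x| <= d2 -> forall v, `|v| <= 1 ->
      `|'d (f q.1) x' ('d (bchart X m q.1) (bchartV X m q.1 x') v) -
        'd (bchart Y m q.1) (bchartV Y m q.1 (f q.1 x')) ('d (f m) x v)| <= e1)]].
  have : \forall m' \near m, [/\ base_ok m',
    (forall x' : X m', `|x' - bchart X m m' x| <= d1 ->
      `|f m' x' - bchart Y m m' (f m x)| <= e3 / 4) &
    (forall x' : X m', `|x' - bchart X m m' x| <= d2 -> forall v, `|v| <= 1 ->
      `|'d (f m') x' ('d (bchart X m m') (bchartV X m m' x') v) -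
        'd (bchart Y m m') (bchartV Y m m' (f m' x')) ('d (f m) x v)| <= e1)].
    by apply: filterS3 NB N1 N2 => m' ? ? ?; split.
  by move=> /cvg_fst; apply.
apply: (@filterS _ (nbhs (m, z0)) _ _ _ _
  (filterI (filterI Ntau Nx) (filterI ND NB'))) => -[m' z] /= [[Tq xq] [[im' jm'] [[mm' nm' Um' l1 l2] fq dfq]]] _.
set x' := bchart X i m' z in xq *.
have xd : `|x' - bchart X m m' x| <= 2 * d.
  rewrite -[X in `|X - _|](c1_chartVK hX mm' x') (le_trans (l1 _ _)) //.
  by rewrite ler_wpM2l // ltW.
have dE : 2 * d = Num.min d1 d2 by rewrite mulrC divfK.
have [xd1 xd2] : `|x' - bchart X m m' x| <= d1 /\ `|x' - bchart X m m' x| <= d2.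
  by apply/andP; rewrite -le_min -dE.
have {}fq := fq _ xd1; have {}dfq := dfq _ xd2.
set y' := f m' x' in fq dfq.
have Tht : forall w, `|tht (m', bchartV Y m m' y') w - tht (m, y) w| <= e1 * `|w|.
  apply: opnorm_sub_le; apply: (UV (m', bchartV Y m m' y')); last by split.
  split=> //=; apply: Ve; rewrite /= distrC.
  rewrite -[X in _ - X](c1_chartK hY nm' y) (le_lt_trans (l2 _ _)) //.
  by move: fq e30; lra.
have Tau : forall w, `|tau (m', z) w - tau (m, z0) w| <= e1 * `|w|.
  by apply: opnorm_sub_le; apply: Tq; split.
pose eta := bchartV Y m m' y'.
pose Phi := 'd (bchart X m m') (bchartV X m m' x') : X m -> X m'.
pose Psi := 'd (bchart Y m m') eta : Y m -> Y m'.
have Dfq : forall w, `|'d (f m') x' (Phi w) - Psi ('d (f m) x w)| <= e1 * `|w|.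
  apply: (@le_norm_scale _ _ _ (fun w => 'd (f m') x' (Phi w) - Psi ('d (f m) x w))) => //.
  - by move=> k v _; rewrite /Phi /Psi /= !linearZ /=; lmod R.
  - by rewrite /Phi /Psi /= !linear0 addr0.
have dV w : `|'d (bchartV Y m m') y' w| <= 2 * `|w|.
  apply: diff_lipschitz; last exact: differentiable_bchartV.
  by move=> [a b] _; exact: l2.
apply/opnorm_leP => v v1.
rewrite -[X in `|X|]/('d (bchartV Y j m') y' ('d (f m') x' ('d (bchart X i m') z v)) -
  'd (bchartV Y j m) y ('d (f m) x ('d (bchart X i m) z0 v))).
rewrite (diff_chart_transition z v hX im' mm') (diff_chart_transition z0 v hX im mX).
rewrite (diff_chartV_transition _ _ hY jm' nm') (diff_chartV_transition _ _ hY jm mY).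
rewrite (diff_bchart_id hX) (diff_bchartV_id hY) (bchartV_id hY).
rewrite -/(tau (m', z) v) -/(tau (m, z0) v).
set a := 'd (transition X i m m') z v; set a0 := 'd (transition X i m m) z0 v.
have aa0 : `|a - a0| <= e1.
  by rewrite (le_trans (Tau v)) // ler_piMr // ltW.
have a0K : `|a0| <= K2 by rewrite (le_trans (tau0 v)) // ler_piMr.
have aA : `|a| <= A.
  rewrite -[a](subrK a0) (le_trans (ler_normD _ _)) // [leLHS]addrC lerD //.
  exact: le_trans aa0 e11.
pose w' := 'd (f m') x' (Phi a); pose B := 'd (f m) x a; pose B0 := 'd (f m) x a0.
(* The discrepancy of the center representative, read in the fiber over [m]; the differential of the
   inverse chart costs a factor 2. *)
pose err := 'd (bchartV Y m m') y' w' - B.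
have errE : `|err| <= 2 * (e1 * A).
  have -> : err = 'd (bchartV Y m m') y' (w' - Psi B).
    rewrite linearB /= /Psi /err; congr (_ - _).
    have := diff_bchartK hY eta B nm'.
    by rewrite /eta (c1_chartVK hY nm').
  by rewrite (le_trans (dV _)) // ler_wpM2l // (le_trans (Dfq a)) // ler_wpM2l // ltW.
set W := 'd (bchartV Y m m') y' _.
have WE : W = B + err by rewrite /err addrC subrK.
rewrite -[X in `|X - _|]/(tht (m', eta) W) -[X in `|_ - X|]/(tht (m, y) B0).
have T1 := Tht W.
have T2 := tht0 err; have T3 := tht0 (B - B0).
have T4 : `|W| <= C * A + 2 * (e1 * A).
  rewrite WE (le_trans (ler_normD _ _)) // lerD // (le_trans (df_le _ _)) //.
  by rewrite ler_wpM2l.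
have T5 : `|B - B0| <= C * e1.
  by rewrite /B /B0 -linearB (le_trans (df_le _ _)) // ler_wpM2l.
have thtE : tht (m, y) W = tht (m, y) B0 + tht (m, y) (B - B0) + tht (m, y) err.
  have -> : W = B0 + (B - B0) + err by rewrite WE; lmod R.
  by rewrite /tht !linearD.
have T6 := ler_distD (tht (m, y) W) (tht (m', eta) W) (tht (m, y) B0).
have T7 : `|tht (m, y) W - tht (m, y) B0| <= K1 * (C * e1) + K1 * (2 * (e1 * A)).
  have -> : tht (m, y) W - tht (m, y) B0 = tht (m, y) (B - B0) + tht (m, y) err.
    by rewrite thtE; lmod R.
  rewrite (le_trans (ler_normD _ _)) // lerD //.
    by rewrite (le_trans T3) // ler_wpM2l.
  by rewrite (le_trans T2) // ler_wpM2l.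
have T8 : e1 * `|W| <= e1 * (C * A + 2 * (e1 * A)) by rewrite ler_wpM2l // ltW.
have T9 : e1 * (e1 * A) <= e1 * A by rewrite ler_wpM2l ?(ltW e10) // ler_piMl.
rewrite (le_trans T6) // (le_trans (lerD T1 T7)) //.
rewrite (le_trans (lerD T8 (lexx _))) // (le_trans _ e1K) // -subr_ge0.
set D := (X in 0 <= X).
have -> : D = 2 * (e1 * A - e1 * (e1 * A)) + e1 by rewrite /D /K; ring.
by rewrite addr_ge0 ?(ltW e10) // mulr_ge0 // subr_ge0.
Qed.

End VerticalContinuity.

(** * Moduli of continuity in the fibers *)

Section FiberwiseModulus.
Context {R : realType} {M : topologicalType} (X Y : banach_bundle R M) (u : M -> M).
Variables (F : forall m, X m * Y (u m) -> X (u m))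
          (G : forall m, X m * Y (u m) -> Y m).
Context {q C : R} {Gam : M -> R -> Prop} {p th b ls lu : M -> R}.
Variable gd : gap_data F G q C Gam p th b ls lu.
Variables (f : forall m, X m -> Y m) (xm : forall m, X m -> X (u m)).
Arguments f : clear implicits.
Arguments xm : clear implicits.
Hypotheses (f_lip : forall m x y, `|f m x - f m y| <= b m * `|x - y|).
Hypotheses (xm_lip : forall m x y, `|xm m x - xm m y| <= ls m * `|x - y|).
Hypotheses (fixF : forall m x, @F m (x, f (u m) (xm m x)) = xm m x).
Hypotheses (fixG : forall m x, @G m (x, f (u m) (xm m x)) = f m x).
Hypotheses (hX : C1_topology_bundle X) (hY : C1_topology_bundle Y).
Hypotheses (dF : forall m z, differentiable (@F m) z).
Hypotheses (dG : forall m z, differentiable (@G m) z).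
Context {I : Type} (s : I -> I) (B : I -> set M).
Hypothesis B_next : forall i m, B i m -> B (s i) (u m).

(** [B i] is a set of base points sharing one modulus. Singletons, with [u] acting on the index,
    give uniform continuity in each fiber; the whole base, with a one-element index type, gives
    equicontinuity. *)
Definition modulus_on (V W : M -> normedModType R) (D : forall m, V m -> V m -> W m) :=
  forall i (e : R), 0 < e -> exists2 d : R, 0 < d & forall m, B i m ->
    forall z z' : V m, `|z - z'| <= d -> (opnorm (D m z \- D m z')%R <= e%:E)%E.

Hypotheses (mF : modulus_on (fun m z => 'd (@F m) z : X m * Y (u m) -> X (u m))).
Hypotheses (mG : modulus_on (fun m z => 'd (@G m) z : X m * Y (u m) -> Y m)).

Let P (i : I) : set_system (pair_config X) := fun A =>
  exists2 d : R, 0 < d & forall m, B i m -> forall x x' : X m,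
    `|x - x'| <= d -> A (PairConfig x x').

Let P_filter i : Filter (P i).
Proof.
split; first by exists 1.
- move=> A A' [d d0 Ad] [d' d'0 Bd]; exists (Num.min d d').
    by rewrite lt_min d0.
  move=> m im x x'; rewrite le_min => /andP[xd xd'].
  by split; [exact: Ad|exact: Bd].
- by move=> A A' AA [d d0 Ad]; exists d => // m im x x' xd; exact/AA/Ad.
Qed.

Let P_next i A : P (s i) A -> P i ((next_pair xm) @^-1` A).
Proof.
case=> d d0 H; have C0 := gd_C gd.
have C1 : 0 < C + 1 by rewrite ltr_wpDl.
exists (d / (C + 1)); first by rewrite divr_gt0.
move=> m im x x' xd; apply: H; first exact: B_next.
have /andP[l0 lC] := gd_ls gd m.
rewrite (le_trans (xm_lip _ _)) //.
have : ls m * `|x - x'| <= (C + 1) * (d / (C + 1)).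
  by rewrite ler_pM // ler_wpDr.
by rewrite [(C + 1) * _]mulrC divfK ?gt_eqF.
Qed.

(** On the pairs considered both points lie over one base point, where the centered chart is the
    identity and so is [Phi]. The chart form is needed because the two fibers of a [pair_config]
    have a priori different types. *)
Let Phi (c : pair_config X) : X (pm c) -> X (pm' c) :=
  'd (bchart X (pm c) (pm' c)) (bchartV X (pm c) (pm' c) (px' c)).
Let Psi (c : pair_config X) : Y (pm c) -> Y (pm' c) :=
  'd (bchart Y (pm c) (pm' c)) (bchartV Y (pm c) (pm' c) (f (pm' c) (px' c))).

Let bound i : \forall c \near P i,
  (forall v, `|Phi (c := c) v| <= 2 * `|v|) /\
  (forall v, `|Psi (c := c) v| <= 2 * `|v|).
Proof.
exists 1 => // m im x x' _; rewrite /Phi /Psi /=.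
by split=> v; rewrite ?(diff_bchart_id hX) ?(diff_bchart_id hY) ler_peMl // ler1n.
Qed.

Let rateP i : \forall c \near P i, th (pm' c) * ls (pm c) * lu (pm' c) <= q.
Proof. by exists 1 => // m im x x' _; exact: (gd_rate gd m). Qed.

Let error i e : 0 < e -> \forall c \near P i, forall v w,
  `|'d (@F (pm' c)) (graph_pt f xm (px' c)) (Phi (c := c) v, Psi (c := next_pair xm c) w) -
    Phi (c := next_pair xm c) ('d (@F (pm c)) (graph_pt f xm (px c)) (v, w))|
    <= e * (`|v| + `|w|) /\
  `|'d (@G (pm' c)) (graph_pt f xm (px' c)) (Phi (c := c) v, Psi (c := next_pair xm c) w) -
    Psi (c := c) ('d (@G (pm c)) (graph_pt f xm (px c)) (v, w))|
    <= e * (`|v| + `|w|).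
Proof.
move=> e0; have [d1 d10 H1] := mF i e0; have [d2 d20 H2] := mG i e0.
have C0 := gd_C gd; have K0 : 0 < C * C + 1 by rewrite ltr_wpDl // mulr_ge0.
(* [C * C + 1] is a Lipschitz constant of the graph map [graph_pt]. *)
exists (Num.min d1 d2 / (C * C + 1)); first by rewrite divr_gt0 // lt_min d10.
move=> m im x x'; rewrite ler_pdivlMr // => xd.
have zd : `|graph_pt f xm x' - graph_pt f xm x| <= Num.min d1 d2.
  rewrite (le_trans _ xd) // -[X in `|X|]/(x' - x, f (u m) (xm m x') - f (u m) (xm m x)).
  have bb := gd_b gd (u m); have ll := gd_ls gd m.
  have A1 : `|f (u m) (xm m x') - f (u m) (xm m x)| <= C * (C * `|x' - x|).
    case/andP: bb => b0 bC; case/andP: ll => l0 lC.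
    rewrite (le_trans (f_lip _ _)) // ler_pM //.
    by rewrite (le_trans (xm_lip _ _)) // ler_wpM2r.
  rewrite (le_trans (norm_pair_le _ _)) //.
  by rewrite [`|x - x'|]distrC; move: A1; lra.
move: zd; rewrite le_min => /andP[/(H1 _ im)/opnorm_sub_le D1 /(H2 _ im)/opnorm_sub_le D2].
move=> v w; rewrite /Phi /Psi /= !(diff_bchart_id hX) !(diff_bchart_id hY).
have vw : e * `|(v, w)| <= e * (`|v| + `|w|).
  by rewrite ler_wpM2l ?(ltW e0) // norm_pair_le.
by split; rewrite (le_trans _ vw).
Qed.

Lemma modulus_invariant : modulus_on (fun m z => 'd (f m) z : X m -> Y m).
Proof.
move=> i e e0.
have [d d0 H] := differential_comparison gd f_lip xm_lip fixF fixG dF dG (gd_q gd)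
  P_filter P_next rateP bound error i e0.
exists d => // m im x x' xd; apply/opnorm_leP => v v1.
have := H m im x' x; rewrite distrC => /(_ xd v v1).
by rewrite /Phi /Psi /= (diff_bchart_id hX) (diff_bchart_id hY).
Qed.

End FiberwiseModulus.

(** * Invariance of the section under [xm], the rate between nearby fibers, and the theorem *)

Lemma invariant_section_image (R : realType) (M : Type) (X Y : banach_bundle R M)
    (u : M -> M) (F : forall m, X m * Y (u m) -> X (u m))
    (G : forall m, X m * Y (u m) -> Y m) (q C : R) (Gam : M -> R -> Prop)
    (p th b ls lu : M -> R) (f : forall m, X m -> Y m)
    (xm : forall m, X m -> X (u m)) (iX : forall m, X m) (iY : forall m, Y m) :
  gap_data F G q C Gam p th b ls lu ->
  (forall m (x y : X m), `|f m x - f m y| <= b m * `|x - y|) ->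
  (forall m x, F m (x, f (u m) (xm m x)) = xm m x) ->
  invariant_section F G iX iY -> (forall m, f m (iX m) = iY m) ->
  forall m, xm m (iX m) = iX (u m).
Proof.
move=> gd f_lip fixF inv f_i m; have /andP[q0 q1] := gd_q gd.
have [Fi _] := inv m.
(* The aperture 0 cone over [iX m] bounds the distance from [xm m (iX m)] to [iX (u m)] by [p] times
   the distance of their [f]-images, hence by [p * b <= q < 1] times itself. *)
have [] := gd_cone gd (gd_Gam0 gd m) (x := iX m) (x' := iX m)
  (y := iY (u m)) (y' := f (u m) (xm m (iX m))) (lexx 0).
  by rewrite subrr normr0 mul0r addr0.
rewrite fixF Fi mulr0 addr0 => H _.
have /andP[p0 _] := gd_p gd m.
have := ler_wpM2l p0 (f_lip (u m) (xm m (iX m)) (iX (u m))).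
rewrite f_i mulrA => /(le_trans H) {}H.
have {}H := le_trans H (ler_wpM2r (normr_ge0 _) (gd_pb gd m)).
apply/eqP; rewrite -subr_eq0 -normr_le0 -(pmulr_rle0 _ (_ : 0 < 1 - q)) ?subr_gt0 //.
by rewrite mulrBl mul1r subr_le0.
Qed.

(** Replacing [ls m] by [ls m'] costs at most [th * lu * (2 * eps)], and the bound on [eps] keeps
    this below half of the gap [1 - q]. The factor 2 is there because the limsup only gives bounds
    strictly above [eps]. *)
Lemma near_rate (R : realType) (M : topologicalType) (L : local_metrics R M)
    (X Y : banach_bundle R M) (u : M -> M)
    (F : forall m, X m * Y (u m) -> X (u m))
    (G : forall m, X m * Y (u m) -> Y m) (q C eps : R) (Gam : M -> R -> Prop)
    (p th b ls lu : M -> R) :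
  locally_metrizable L -> gap_data F G q C Gam p th b ls lu ->
  almost_continuous L eps ls -> 0 < eps -> eps * (4 * (C + 1)) <= (1 - q) ^+ 2 ->
  forall m, \forall m' \near m, th m' * ls m * lu m' <= (1 + q) / 2.
Proof.
move=> hL gd cls e0 eC m; have /andP[q0 q1] := gd_q gd; have C0 := gd_C gd.
have e2 : eps < 2 * eps by rewrite ltr_pMl // ltr1n.
apply: filterS (almost_continuous_near m hL e2 cls) => m' lm.
have /andP[th1 thT] := gd_th gd m'; have /andP[lu0 luC] := gd_lu gd m'.
have th0 : 0 <= th m' by rewrite (le_trans _ th1).
have q1' : 0 < 1 - q by rewrite subr_gt0.
have lsm : ls m <= ls m' + 2 * eps.
  by rewrite -lerBlDl (le_trans _ lm) // distrC ler_norm.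
have tl : th m' * lu m' <= (1 - q)^-1 * C by rewrite ler_pM.
have T1 : th m' * lu m' * ls m <= th m' * lu m' * (ls m' + 2 * eps).
  by rewrite ler_wpM2l // mulr_ge0.
have T2 : th m' * lu m' * (2 * eps) <= (1 - q)^-1 * C * (2 * eps).
  by rewrite ler_wpM2r // mulr_ge0 // ltW.
have T3 : (1 - q)^-1 * C * (2 * eps) <= (1 - q) / 2.
  rewrite -mulrA ler_pdivrMl //.
  by move: eC (ltW e0); rewrite expr2; lra.
by have := gd_rate gd m'; move: T1 T2 T3; lra.
Qed.

Theorem lemma6p26 (R : realType) (q C : R) (hq : q < 1) :
  exists2 eps : R, 0 < eps &
  forall (M : topologicalType) (L : local_metrics R M) (M1 : set M)
    (X Y : banach_bundle R M) (u : M -> M)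
    (F : forall m, X m * Y (u m) -> X (u m))
    (G : forall m, X m * Y (u m) -> Y m)
    (iX : forall m, X m) (iY : forall m, Y m)
    (alpha alpha' beta beta' lambda_u lambda_s theta : M -> R)
    (f : forall m, X m -> Y m),
  (* the setting *)
  invariant_section F G iX iY ->
  (* the (A')(B) or (A)(B) condition and the spectral gap condition, with (H5') *)
  spectral_setting F G L eps C q
    alpha alpha' beta beta' lambda_u lambda_s theta ->
  invariant_map F G beta' lambda_s iX iY f ->
  (* (H1a), (H2)(i, iv, v1'), (H3'), (H4) *)
  locally_metrizable L ->
  C1_topology_bundle X -> C1_topology_bundle Y ->
  almost_isometric_charts L eps X -> almost_isometric_charts L eps Y ->
  continuous_section (B := bprod X Y id) (fun m => (iX m, iY m)) ->
  continuous u -> (forall m, M1 (u m)) ->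
  (* (b) *)
  continuous_bmap (A := bprod X Y u) (B := X) (u := u) F ->
  continuous_bmap (A := bprod X Y u) (B := Y) (u := id) G ->
  (forall m, C1 (F m)) -> (forall m, C1 (G m)) ->
  continuous_vmap (A := bprod X Y u) (B := X) (u := u) F
    (Dv (A := bprod X Y u) (B := X) (u := u) F) ->
  continuous_vmap (A := bprod X Y u) (B := Y) (u := id) G
    (Dv (A := bprod X Y u) (B := Y) (u := id) G) ->
  (* (1) *)
  [/\ (forall m x, differentiable (f m) x) /\
      continuous_vmap (A := X) (B := Y) (u := id) f (K1 f),
  (* (2) *)
      (forall m, op_unif_continuous (Dv (A := bprod X Y u) (B := X) F m)) ->
      (forall m, op_unif_continuous (Dv (A := bprod X Y u) (B := Y) (u := id) G m)) ->
      forall m, op_unif_continuous (K1 f m) &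
      op_equicontinuous (Dv (A := bprod X Y u) (B := X) (u := u) F) ->
      op_equicontinuous (Dv (A := bprod X Y u) (B := Y) (u := id) G) ->
      op_equicontinuous (K1 f)].
Proof.
have q1' : 0 < 1 - q by rewrite subr_gt0.
(* The absolute value is there because [C] is only known to be nonnegative once the base has a
   point, and [eps] is chosen before the base. *)
pose K : R := 4 * (`|C| + 1).
have K0 : 0 < K by rewrite mulr_gt0 // ltr_wpDl.
(* The first entry makes the charts bi-Lipschitz with constant 2 near their centers; the second one
   is the requirement of [near_rate]. *)
pose eps := Num.min 2^-1 ((1 - q) ^+ 2 / K).
have eps0 : 0 < eps by rewrite lt_min invr_gt0 ltr0n divr_gt0 // exprn_gt0.
have eps1 : eps < 1.
  by rewrite gt_min invf_lt1 ?ltr1n // orTb.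
have epsK : eps * K <= (1 - q) ^+ 2 by rewrite -ler_pdivlMr // ge_min lexx orbT.
exists eps => // M L M1 X Y u F G iX iY alpha alpha' beta beta' lambda_u lambda_s
  theta f inv set_ [f_lip f_i [xm xmP]] hL hX hY aX aY ci cu _ cF cG C1F C1G vF vG.
(* Over an empty base the signs of [q] and [C] are unknown, but every conclusion is vacuous. *)
have [[m0 _]|M0] := pselect (exists m : M, True); last first.
  have noM (m : M) : False by apply: M0; exists m.
  split; first by split=> [m|i j [m z]]; have := noM m.
    by move=> _ _ m; have := noM m.
  by move=> _ _ e e0; exists 1 => // m; have := noM m.
have [Gam [p gd]] := spectral_gap_data m0 hq set_.
have {}f_lip m x y := lipschitzP (f_lip m) x y.
have xm_lip m x y := lipschitzP (proj1 (xmP m)) x y.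
have fixF m x := proj1 (proj2 (xmP m) x).
have fixG m x := proj2 (proj2 (xmP m) x).
have xm_i := invariant_section_image gd f_lip fixF inv f_i.
have lX := almost_isometric_near hL hX eps1 aX.
have lY := almost_isometric_near hL hY eps1 aY.
have [_ [_ _ _ _ [_ als]] _] := set_.
have C0 := gd_C gd.
have eC : eps * (4 * (C + 1)) <= (1 - q) ^+ 2.
  by rewrite (le_trans _ epsK) // /K ger0_norm.
have rate := near_rate hL gd als eps0 eC.
have /andP[q0 _] := gd_q gd.
have q2_01 : 0 <= (1 + q) / 2 < 1.
  by rewrite divr_ge0 ?addr_ge0 //= ltr_pdivrMr // mul1r -[2]/(1 + 1) ltrD2l.
have dF m z : differentiable (F m) z by have [] := C1F m.
have dG m z : differentiable (G m) z by have [] := C1G m.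
have df m x : differentiable (f m) x.
  by have [] := differentiable_invariant gd f_lip xm_lip fixF fixG dF dG x.
split.
- split; first exact: df.
  refine (@continuous_vmap_center R M X Y hX hY lX lY f C C0 _ _ _).
  + move=> m x v; have /andP[b0 bC] := gd_b gd m.
    rewrite (@le_trans _ _ (beta' m * `|v|)) //; last by rewrite ler_wpM2r.
    by apply: diff_lipschitz => // -[y z] _; exact: f_lip.
  + move=> m x e e0.
    have [d d0 H] := invariant_near gd f_lip xm_lip fixF fixG f_i xm_i hX hY lX lY
      ci cu cF cG q2_01 rate x e0.
    by exists d => //; apply: filterS H => m' H x' /H[].
  + exact: (center_continuity gd f_lip xm_lip fixF fixG f_i xm_i hX hY lX lY
      ci cu cF cG dF dG vF vG q2_01 rate).
- move=> uF uG m e e0.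
  have [|||d d0 H] := @modulus_invariant R M X Y u F G q C Gam p theta beta'
    lambda_s lambda_u gd f xm f_lip xm_lip fixF fixG hX hY dF dG M u
    (fun m => [set m]) _ _ _ m e e0.
  + by move=> i m' ->.
  + by move=> i e' e'0; have [d d0 H] := uF i e' e'0; exists d => // m' ->.
  + by move=> i e' e'0; have [d d0 H] := uG i e' e'0; exists d => // m' ->.
  + by exists d => // x x'; exact: H.
move=> uF uG e e0.
have [|||d d0 H] := @modulus_invariant R M X Y u F G q C Gam p theta beta'
  lambda_s lambda_u gd f xm f_lip xm_lip fixF fixG hX hY dF dG unit id
  (fun=> setT) _ _ _ tt e e0.
- by [].
- by move=> i e' e'0; have [d d0 H] := uF e' e'0; exists d => // m' _; exact: H.
- by move=> i e' e'0; have [d d0 H] := uG e' e'0; exists d => // m' _; exact: H.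
by exists d => // m x x'; exact: H.
Qed.
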